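(* Let $\mathsf{K} \subset \mathbb{R}^n$ be a nonempty convex body with rotation volume random variable $\mathring{I}_{\mathsf{K}}$ and central rotation volume $\mathring{\delta}(\mathsf{K}) = \mathbb{E}\,\mathring{I}_{\mathsf{K}}$. Then for all $t \geq 0$, $$ \mathbb{P}\left\{ \left| \mathring{I}_{\mathsf{K}} - \mathring{\delta}(\mathsf{K}) \right| \geq t \right\} \leq 2 \exp\left( \frac{-t^2/2}{\mathring{\sigma}^2(\mathsf{K}) + t/3} \right), \quad\text{where}\quad \mathring{\sigma}^2(\mathsf{K}) := \mathring{\delta}(\mathsf{K}). $$
   Context: Let $n \geq 1$ be an integer. A convex body in $\mathbb{R}^n$ is a compact convex subset of $\mathbb{R}^n$ (it may have empty interior). $\mathsf{B}^n$ is the closed Euclidean unit ball, $\kappa_j = \pi^{j/2}/\Gamma(1+j/2)$ and $\omega_j = j\kappa_j = 2\pi^{j/2}/\Gamma(j/2)$ are the volume and surface area of the $j$-dimensional unit ball. The intrinsic volumes $V_0(\mathsf{K}),\dots,V_n(\mathsf{K})$ of a nonempty convex body $\mathsf{K}\subset\mathbb{R}^n$ are the numbers determined by Steiner's formula $\mathrm{Vol}_n(\mathsf{K}+\lambda \mathsf{B}^n) = \sum_{i=0}^n \lambda^{n-i}\kappa_{n-i}\, V_i(\mathsf{K})$ for all $\lambda\geq 0$, where $+$ is Minkowski sum. Rotation volumes and total rotation volume: $\mathring{V}_i(\mathsf{K}) := \frac{\omega_{n+1}}{\omega_{i+1}} V_{n-i}(\mathsf{K})$ for $i=0,\dots,n$,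 and $\mathring{W}(\mathsf{K}) := \sum_{i=0}^n \mathring{V}_i(\mathsf{K})$. The rotation volume random variable $\mathring{I}_{\mathsf{K}}$ takes values in $\{0,1,\dots,n\}$ with $\mathbb{P}\{\mathring{I}_{\mathsf{K}} = n-i\} = \mathring{V}_i(\mathsf{K})/\mathring{W}(\mathsf{K})$. Its expectation $\mathring{\delta}(\mathsf{K}) := \mathbb{E}\,\mathring{I}_{\mathsf{K}}$ is the central rotation volume. In the degenerate case $t=0$ and $\mathring{\delta}(\mathsf{K})=0$, the quotient $0/0$ in the exponent is read as $0$. *)

(* Defs.v *)
From HB Require Import structures.
From mathcomp Require Import all_boot all_order all_algebra.
From mathcomp Require Import all_classical all_reals all_analysis.
Import Order.TTheory GRing.Theory Num.Theory.
Import numFieldNormedType.Exports.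

Set Implicit Arguments.
Unset Strict Implicit.
Unset Printing Implicit Defensive.

Local Open Scope classical_set_scope.
Local Open Scope ring_scope.

(* n-dimensional Lebesgue measure as the iterated product of the
   one-dimensional one: each step is the formula defining the library's
   product measure, [(m1 \x m2) A = \int[m1]_x m2 (xsection A x)], read on
   row vectors through 'rV_n.+1 = R * 'rV_n.  The single point of 'rV_0 has
   mass 1.  Only values on Borel sets are meaningful. *)
Fixpoint volume (R : realType) (n : nat) : set 'rV[R]_n -> \bar R :=
  match n return set 'rV[R]_n -> \bar R with
  | 0 => fun A => (\1_A 0)%:E
  | n'.+1 => fun A => (\int[@lebesgue_measure R]_x
      volume [set v : 'rV[R]_n' | A (row_mx x%:M v : 'rV[R]_(1 + n'))])%E
  end.

(* The norm of 'rV[R]_n in the library is the sup norm, hence the explicit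
   Euclidean one. *)
Definition euclidean_unit_ball (R : realType) (n : nat) : set 'rV[R]_n :=
  [set x | Num.sqrt (\sum_(i < n) x ord0 i ^+ 2) <= 1].

Definition minkowski_sum (R : realType) (n : nat) (A B : set 'rV[R]_n) :
  set 'rV[R]_n := [set x + y | x in A & y in B].

Definition dilation (R : realType) (n : nat) (l : R) (A : set 'rV[R]_n) :
  set 'rV[R]_n := [set l *: x | x in A].

Definition convex_body (R : realType) (n : nat) (K : set 'rV[R]_n) : Prop :=
  compact K /\ convex_set K.

Definition Gamma (R : realType) (x : R) : R :=
  \int[@lebesgue_measure R]_(t in `]0, +oo[) (t `^ (x - 1) * expR (- t)).

Definition kappa (R : realType) (j : nat) : R :=
  pi `^ (j%:R / 2) / Gamma (1 + j%:R / 2).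

Definition omega (R : realType) (j : nat) : R := j%:R * kappa R j.

Definition steiner_formula (R : realType) (n : nat) (K : set 'rV[R]_n)
    (V : 'I_n.+1 -> R) : Prop :=
  forall l : R, 0 <= l ->
    volume (minkowski_sum K (dilation l (@euclidean_unit_ball R n))) =
    (\sum_(i < n.+1) l ^+ (n - i) * kappa R (n - i) * V i)%:E.

(* The coefficients determined by Steiner's formula: they exist and are unique
   for a nonempty convex body, so the default value 0 is never used there. *)
Definition intrinsic_volume (R : realType) (n : nat) (K : set 'rV[R]_n) :
  'I_n.+1 -> R := xget (fun=> 0) [set V | steiner_formula K V].

(* rev_ord i : 'I_n.+1 has value n - i. *)
Definition rotation_volume (R : realType) (n : nat) (K : set 'rV[R]_n)
    (i : 'I_n.+1) : R :=
  omega R n.+1 / omega R i.+1 * intrinsic_volume K (rev_ord i).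

Definition total_rotation_volume (R : realType) (n : nat)
    (K : set 'rV[R]_n) : R :=
  \sum_(i < n.+1) rotation_volume K i.

Definition rotation_volume_rv (R : realType) (n : nat) (K : set 'rV[R]_n)
    (d : measure_display) (T : measurableType d) (P : probability T R)
    (I : {RV P >-> R}) : Prop :=
  (forall w, exists k : 'I_n.+1, I w = k%:R) /\
  (forall i : 'I_n.+1, P [set w | I w = (n - i)%:R] =
     (rotation_volume K i / total_rotation_volume K)%:E).

Definition central_rotation_volume (R : realType) (d : measure_display)
    (T : measurableType d) (P : probability T R) (I : {RV P >-> R}) : R :=
  fine 'E_P[I].

(* Main.v *)
(** Let [V_i] be the intrinsic volumes of [K] and [B] the unit ball. By Steiner's formula,
    [Q s = \int_(l >= 0) e^(-l) Vol(s K + l B) dl = \sum_i s^i kappa_(n-i) (n-i)! V_i],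
    and [kappa_j j! = 2 (2 pi)^j / omega_(j+1)] makes [Q] a positive multiple of
    [s |-> E (s / 2 pi)^I], the generating function of the rotation volume variable [I].
    Since [(1-a)(s K + l B) + a (s' K + l' B)] is contained in the body with the
    averaged parameters, the Prekopa-Leindler inequality makes [Q] log-concave.
    So the concave function [s |-> ln E s^I] lies below its tangent at [s = 1], i.e.
    [E s^I <= exp (delta (s - 1))]: the variable is sub-Poissonian, and Chernoff's
    method gives Bernstein's inequality with variance proxy [delta].

    In dimension one, superlevel sets of log-concave functions are intervals, for which
    Prekopa-Leindler reduces to the Brunn-Minkowski inequality for lengths through the
    layer-cake formula. The multiplicative Brunn-Minkowski inequality for the iterated
    volume follows by induction on [n], applied to slices; only bounded convex sets
    occur, so measurability of the slice volumes comes for free. Steiner's formula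
    itself need not be proved: if it failed, [intrinsic_volume K] would be [0] and
    [I] could not have total mass [1]. *)

Require Import Defs.
From HB Require Import structures.
From mathcomp Require Import all_boot all_order all_algebra.
From mathcomp Require Import all_classical all_reals all_analysis.
From mathcomp Require Import measurable_realfun ring lra.
Import Order.TTheory GRing.Theory Num.Theory.
Import numFieldNormedType.Exports.

Set Implicit Arguments.
Unset Strict Implicit.
Unset Printing Implicit Defensive.

Local Open Scope classical_set_scope.
Local Open Scope ring_scope.

(** * Intervals and the layer-cake formula *)

Section intervals.
Context {R : realType}.
Let mu := @lebesgue_measure R.
Implicit Types (I J L : set R) (r a : R).

(** If any two points of [I] were at distance at most [r], then [I] would fit in the segment of
    length [r] ending at [sup I]. Bounding [mu I] strictly from below also covers infinite
    length. *)
Lemma is_interval_gap I r : is_interval I -> I !=set0 -> (r%:E < mu I)%E ->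
  exists x y, [/\ I x, I y, x <= y & r <= y - x].
Proof.
move=> itvI [x0 Ix0] rI.
have [r0|r0] := leP r 0; first by exists x0, x0; split => //; rewrite subrr.
apply: contrapT => noxy.
have gap x y : I x -> I y -> y - x <= r.
  move=> Ix Iy; have [xy|/ltW yx] := leP x y.
    by apply: contra_notT noxy; rewrite -ltNge => /ltW rxy; exists x, y.
  by rewrite (le_trans _ (ltW r0))// subr_le0.
have hasI : has_sup I.
  by split; [exists x0|exists (x0 + r) => y Iy; rewrite -lerBlDl gap].
suff : (mu I <= r%:E)%E by rewrite leNgt rI.
have -> : r%:E = mu `[sup I - r, sup I]%classic.
  rewrite /mu lebesgue_measure_itv/= lte_fin gtrBl r0.
  by rewrite -EFinB opprB addrC subrK.
apply: le_measure; rewrite ?inE//; first exact: is_interval_measurable.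
move=> x Ix /=; rewrite in_itv/=; apply/andP; split.
  by rewrite lerBlDl; apply: ge_sup; [exists x0|move=> y Iy; rewrite -lerBlDr gap].
exact: (sup_upper_bound hasI).
Qed.

Lemma le_measure_is_interval L x y : is_interval L -> L x -> L y -> x <= y ->
  ((y - x)%:E <= mu L)%E.
Proof.
move=> itvL Lx Ly xy.
have -> : (y - x)%:E = mu `[x, y]%classic.
  rewrite /mu lebesgue_measure_itv/= lte_fin.
  by case: ltgtP xy => // -> _; rewrite subrr.
apply: le_measure; rewrite ?inE//; first exact: is_interval_measurable.
by move=> z /=; rewrite in_itv/=; exact: itvL.
Qed.

(** Points of [I] at least [r] apart and points of [J] at least [s] apart combine to points of [L]
    at least [(1 - a) r + a s] apart; then [r] and [s] approach the two lengths. *)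
Lemma brunn_minkowski_intervals I J L a : 0 < a < 1 ->
  is_interval I -> is_interval J -> is_interval L ->
  I !=set0 -> J !=set0 ->
  (forall x y, I x -> J y -> L ((1 - a) * x + a * y)) ->
  ((1 - a)%:E * mu I + a%:E * mu J <= mu L)%E.
Proof.
move=> /andP[a0 a1] itvI itvJ itvL I0 J0 IJL.
have b0 : 0 < 1 - a by rewrite subr_gt0.
have key r s : (r%:E < mu I)%E -> (s%:E < mu J)%E ->
    (((1 - a) * r + a * s)%:E <= mu L)%E.
  move=> /(is_interval_gap itvI I0)[x [x' [Ix Ix' xx' rx]]].
  move=> /(is_interval_gap itvJ J0)[y [y' [Jy Jy' yy' sy]]].
  apply: (@le_trans _ _
      ((1 - a) * x' + a * y' - ((1 - a) * x + a * y))%:E); last first.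
    by apply: le_measure_is_interval => //; [exact: IJL|exact: IJL|nra].
  by rewrite lee_fin; nra.
have mu_ge0 A : (0 <= mu A)%E by exact: measure_ge0.
case muL : (mu L) => [m| |]; last 2 first.
- by rewrite leey.
- by have := mu_ge0 L; rewrite muL.
rewrite muL in key.
have I0' := mu_ge0 I; have J0' := mu_ge0 J.
have N1 A : (0 <= mu A)%E -> ((-1)%:E < mu A)%E by apply: lt_le_trans; rewrite lte_fin ltrN10.
case muI : (mu I) => [i| |]; last 2 first.
(* If [mu I] is infinite, this [r], paired with [-1], forces [L] to have length at least [m + 1]. *)
- exfalso; have := key ((m + 1 + a) / (1 - a)) (-1); rewrite muI ltry => /(_ isT (N1 _ J0')).
  by rewrite lee_fin mulrC divfK ?gt_eqF//; lra.
- by move: I0'; rewrite muI.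
case muJ : (mu J) => [j| |]; last 2 first.
- exfalso; have := key (-1) ((m + 1 + (1 - a)) / a); rewrite muJ ltry => /(_ (N1 _ I0') isT).
  by rewrite lee_fin [a * _]mulrC divfK ?gt_eqF//; lra.
- by move: J0'; rewrite muJ.
rewrite -!EFinM -EFinD lee_fin leNgt; apply/negP => mij.
(* Half the supposed excess: lowering both lengths by [e] lowers their mean by [e], which still
   exceeds [m]. *)
pose e := ((1 - a) * i + a * j - m) / 2.
have e0 : 0 < e by rewrite /e; lra.
have := key (i - e) (j - e); rewrite muI muJ !lte_fin !gtrBl e0 => /(_ isT isT).
by rewrite lee_fin /e; lra.
Qed.

End intervals.

Section layer_cake.
Context {R : realType}.
Let mu := @lebesgue_measure R.
Local Open Scope ereal_scope.

Definition superlevel (f : R -> R) (t : R) : set R := [set x | (t < f x)%R].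

(** Preimages of open rays are superlevel sets, and intervals are Borel. The measurability of slice
    volumes comes from here. *)
Lemma superlevel_measurable_fun (f : R -> R) :
  (forall t, is_interval (superlevel f t)) -> measurable_fun setT f.
Proof.
move=> itvf mD; apply: (measurability _ (RGenOInfty.measurableE R)) => //.
move=> _ [_ [t ->] <-]; rewrite setTI; apply: is_interval_measurable.
rewrite (_ : _ @^-1` _ = superlevel f t); first exact: itvf.
by apply/seteqP; split => x /=; rewrite in_itv/= andbT.
Qed.

(** [f x] is the length of [[0, f x[], and Tonelli exchanges the two integrals. *)
Lemma layer_cake (f : R -> R) : measurable_fun setT f -> (forall x, 0 <= f x)%R ->
  \int[mu]_x (f x)%:E = \int[mu]_(t in `[0%R, +oo[) mu (superlevel f t).
Proof.
move=> mf f0.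
transitivity (\int[mu]_x \int[mu]_t (\1_`[0%R, f x[ t)%:E).
  apply: eq_integral => x _; rewrite integral_indic// setIT.
  rewrite [RHS](lebesgue_measure_itv `[0%R, f x[)/= lte_fin.
  by case: ltgtP (f0 x) => // [fx _|<- _]; rewrite ?sube0.
pose GR := measurableTypeR R.
rewrite (fubini_tonelli (m1 := mu) (m2 := mu)
  (fun p : GR * GR => (\1_`[0, f p.1[ p.2)%:E))//=; last first.
  apply/measurable_EFinP/measurable_indic => /=.
  rewrite [X in measurable X](_ : _ =
      (fun p : GR * GR => (0 <= p.2)%R) @^-1` [set true] `&`
      (fun p : GR * GR => (p.2 < f p.1)%R) @^-1` [set true]); last first.
    by apply/seteqP; split => p /=; rewrite in_itv/= => /andP.
  apply: measurableI.
  - have : measurable_fun setT (fun p : GR * GR => (0 <= p.2)%R) by exact: measurable_fun_ler.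
    by move=> /(_ measurableT [set true]); rewrite setTI; exact.
  - have : measurable_fun setT (fun p : GR * GR => (p.2 < f p.1)%R).
      by apply: measurable_fun_ltr => //; exact: measurableT_comp.
    by move=> /(_ measurableT [set true]); rewrite setTI; exact.
rewrite [in RHS]integral_mkcond; apply: eq_integral => t _; rewrite patchE.
have mS : measurable (superlevel f t).
  have : measurable_fun setT (fun x => (t < f x)%R) by exact: measurable_fun_ltr.
  by move=> /(_ measurableT [set true]); rewrite setTI; exact.
case: ifPn => [|].
  rewrite inE/= in_itv/= andbT => t0.
  rewrite (_ : (fun x => _) = (fun x => (\1_(superlevel f t) x)%:E)).
    by rewrite integral_indic// setIT.
  by apply/funext => x; congr (_%:E); rewrite !indicE; congr (nat_of_bool _)%:R;
    apply/idP/idP; rewrite !inE/= /superlevel/= in_itv/= t0.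
rewrite notin_setE/= in_itv/= andbT => /negP; rewrite -ltNge => t0.
apply: integral0_eq => x _; rewrite indicE memNset//= in_itv/=.
by rewrite leNgt t0.
Qed.

End layer_cake.

(** * The one-dimensional Prekopa-Leindler inequality *)

Section prekopa_leindler.
Context {R : realType}.
Let mu := @lebesgue_measure R.

(** Weighted AM-GM, as Young's inequality for the conjugate exponents [1 / (1 - a)] and [1 / a]. *)
Lemma powR_convex_comb_le (a x y : R) : 0 < a < 1 -> 0 <= x -> 0 <= y ->
  x `^ (1 - a) * y `^ a <= (1 - a) * x + a * y.
Proof.
move=> /andP[a0 a1] x0 y0.
have b0 : 0 < 1 - a by rewrite subr_gt0.
have := @conjugate_powR R (x `^ (1 - a)) (y `^ a) (1 - a)^-1 a^-1.
rewrite !powR_ge0 !invr_gt0 b0 a0 !invrK subrK => /(_ isT isT isT isT erefl).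
rewrite -!powRrM !divff ?gt_eqF// !powRr1//.
by rewrite [x * _]mulrC [y * _]mulrC.
Qed.

Lemma powR_convex_comb_ge_min (a x y t : R) : 0 < a < 1 -> 0 <= t ->
  t < x -> t < y -> t < x `^ (1 - a) * y `^ a.
Proof.
move=> /andP[a0 a1] t0 tx ty; have b0 : 0 < 1 - a by rewrite subr_gt0.
have x0 := le_lt_trans t0 tx; have y0 := le_lt_trans t0 ty.
rewrite le_eqVlt in t0; case/predU1P: t0 => [<-|t0].
  by rewrite mulr_gt0// powR_gt0.
have -> : t = t `^ (1 - a) * t `^ a.
  by rewrite -powRD ?subrK ?powRr1 ?ltW// gt_eqF// implybT.
by rewrite ltr_pM ?powR_ge0// gt0_ltr_powR// ?nnegrE ltW.
Qed.

Definition logconcave_triple (a : R) (f g h : R -> R) :=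
  forall x y, f x `^ (1 - a) * g y `^ a <= h ((1 - a) * x + a * y).

Lemma logconcave_superlevel (f : R -> R) : (forall x, 0 <= f x) ->
  (forall a, 0 < a < 1 -> logconcave_triple a f f f) ->
  forall t, is_interval (superlevel f t).
Proof.
move=> f0 lcf t x y tfx tfy z /andP[].
rewrite le_eqVlt => /predU1P[<-//|xz]; rewrite le_eqVlt => /predU1P[->//|zy].
have [t0|t0] := ltP t 0; first exact: lt_le_trans t0 (f0 _).
have xy : 0 < y - x by rewrite subr_gt0 (lt_trans xz).
pose a := (z - x) / (y - x).
have a01 : 0 < a < 1.
  by apply/andP; split; rewrite /a ?ltr_pdivlMr ?ltr_pdivrMr// ?mul0r ?mul1r; lra.
have -> : z = (1 - a) * x + a * y.
  by rewrite /a; field; rewrite gt_eqF.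
by apply: lt_le_trans (lcf a a01 x y); exact: powR_convex_comb_ge_min.
Qed.

(** The length of the superlevel set is nonincreasing in [t], so its own superlevel sets are
    intervals. *)
Lemma measurable_mu_superlevel (f : R -> R) :
  (forall t, is_interval (superlevel f t)) ->
  measurable_fun setT (fun t => mu (superlevel f t)).
Proof.
move=> itvf mD; apply: (measurability _ (ErealGenOInfty.measurableE R)) => //.
move=> _ [_ [c ->] <-]; rewrite setTI; apply: is_interval_measurable.
move=> x y /= _; rewrite !in_itv/= !andbT => cy z /andP[_ zy].
rewrite in_itv/= andbT; apply: lt_le_trans cy _; apply: le_measure; rewrite ?inE.
- exact: is_interval_measurable.
- exact: is_interval_measurable.
- by move=> u; exact: le_lt_trans.
Qed.

(** When both suprema are [1], the superlevel sets of [f] and [g] are nonempty at the same levels,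
    so Brunn-Minkowski for intervals applies level by level and integrates to an additive
    inequality. *)
Lemma prekopa_leindler_sup1 (a : R) (f g h : R -> R) : 0 < a < 1 ->
  (forall x, 0 <= f x) -> (forall x, 0 <= g x) -> (forall x, 0 <= h x) ->
  (forall t, is_interval (superlevel f t)) ->
  (forall t, is_interval (superlevel g t)) ->
  (forall t, is_interval (superlevel h t)) ->
  (forall x, f x <= 1) -> (forall x, g x <= 1) ->
  (forall t, t < 1 -> superlevel f t !=set0) ->
  (forall t, t < 1 -> superlevel g t !=set0) ->
  logconcave_triple a f g h ->
  ((1 - a)%:E * (\int[mu]_x (f x)%:E) + a%:E * (\int[mu]_x (g x)%:E) <=
    \int[mu]_x (h x)%:E)%E.
Proof.
move=> a01 f0 g0 h0 itvf itvg itvh f1 g1 supf supg lc.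
have /andP[a0 a1] := a01.
have b0 : 0 <= 1 - a by rewrite subr_ge0 ltW.
have {}a0 : 0 <= a by rewrite ltW.
have D01 : measurable (`[0%R, 1%R[%classic : set R) by exact: measurable_itv.
have lvl1 (k : R -> R) : measurable_fun setT k -> (forall x, 0 <= k x) ->
    (forall x, k x <= 1) ->
    (\int[mu]_x (k x)%:E = \int[mu]_(t in `[0%R, 1%R[) mu (superlevel k t))%E.
  move=> mk k0 k1; rewrite layer_cake// [LHS]integral_mkcond [RHS]integral_mkcond.
  apply: eq_integral => t _; rewrite !patchE.
  have [t1|t1] := ltP t 1.
    by congr (if _ then _ else _); apply/idP/idP; rewrite !inE/= !in_itv/= t1 !andbT.
  rewrite [in RHS]memNset/=; last by rewrite in_itv/= ltNge t1 andbF.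
  case: ifP => // _.
  rewrite (_ : superlevel k t = set0); first exact: measure0.
  by rewrite -subset0 => x; rewrite /superlevel/= ltNge (le_trans (k1 x)).
rewrite (lvl1 f)//; last exact: superlevel_measurable_fun.
rewrite (lvl1 g)//; last exact: superlevel_measurable_fun.
rewrite layer_cake//; last exact: superlevel_measurable_fun.
have ms k : (forall t, is_interval (superlevel k t)) -> forall D : set R,
    measurable_fun D (fun t => mu (superlevel k t)).
  by move=> itvk D; apply: measurable_funTS; exact: measurable_mu_superlevel.
rewrite -!ge0_integralZl_EFin//; [|exact: ms|exact: ms].
rewrite -ge0_integralD//; last 4 first.
- by move=> t _; rewrite mule_ge0// lee_fin.
- by apply: measurable_funeM; exact: ms.
- by move=> t _; rewrite mule_ge0// lee_fin.
- by apply: measurable_funeM; exact: ms.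
apply: (@le_trans _ _ (\int[mu]_(t in `[0%R, 1%R[) mu (superlevel h t))%E).
  apply: ge0_le_integral => //.
  - by move=> t _; rewrite adde_ge0// mule_ge0// lee_fin.
  - by apply: emeasurable_funD; apply: measurable_funeM; exact: ms.
  - exact: ms.
  move=> t /=; rewrite in_itv/= => /andP[t0 t1].
  apply: brunn_minkowski_intervals => //; [exact: supf|exact: supg|].
  move=> x y fx gy; apply: lt_le_trans (lc x y).
  exact: powR_convex_comb_ge_min.
(* [h] may exceed [1]; its levels from [1] on only enlarge the right side. *)
apply: ge0_subset_integral => //; first exact: ms.
by move=> t /=; rewrite !in_itv/= => /andP[->].
Qed.

(** Dividing [f] and [g] by their suprema [A] and [B], and [h] by [A^(1-a) B^a], preserves the
    hypothesis on the triple and reduces to suprema [1]. Weighted AM-GM then makes the additive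
    conclusion multiplicative, and the constants cancel. *)
Lemma prekopa_leindler (a M : R) (f g h : R -> R) : 0 < a < 1 ->
  (forall x, 0 <= f x) -> (forall x, 0 <= g x) -> (forall x, 0 <= h x) ->
  (forall t, is_interval (superlevel f t)) ->
  (forall t, is_interval (superlevel g t)) ->
  (forall t, is_interval (superlevel h t)) ->
  (forall x, f x <= M) -> (forall x, g x <= M) ->
  (\int[mu]_x (h x)%:E < +oo)%E ->
  logconcave_triple a f g h ->
  (\int[mu]_x f x) `^ (1 - a) * (\int[mu]_x g x) `^ a <= \int[mu]_x h x.
Proof.
move=> a01 f0 g0 h0 itvf itvg itvh fM gM hfin lc.
have /andP[a0 a1] := a01.
have b0 : 0 < 1 - a by rewrite subr_gt0.
(* A vanishing [Rintegral], which is also the default value for an infinite integral, makes the left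
   side [0]. *)
have [If0|/eqP If0] := eqVneq (\int[mu]_x f x) 0.
  by rewrite If0 powR0 ?gt_eqF// mul0r; exact: Rintegral_ge0.
have [Ig0|/eqP Ig0] := eqVneq (\int[mu]_x g x) 0.
  by rewrite Ig0 powR0 ?(gt_eqF a0)// mulr0; exact: Rintegral_ge0.
have sup_pos (k : R -> R) : (forall x, 0 <= k x) -> (forall x, k x <= M) ->
    \int[mu]_x k x <> 0 ->
    [/\ 0 < sup (range k), forall x, k x <= sup (range k) &
      forall t, t < sup (range k) -> superlevel k t !=set0].
  move=> k0 kM Ik.
  have hsk : has_sup (range k).
    by split; [exists (k 0), 0|exists M => _ [x _ <-]].
  have kle x : k x <= sup (range k) by apply: (sup_upper_bound hsk); exists x.
  split=> //.
    rewrite ltNge; apply/negP => sk; apply: Ik.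
    rewrite /Rintegral integral0_eq// => x _; congr EFin; apply/eqP.
    by rewrite eq_le k0 andbT (le_trans (kle x)).
  by move=> t /(sup_gt hsk.1)[_ [x _ <-] tx]; exists x.
have [A0 fA supf] := sup_pos f f0 fM If0.
have [B0 gB supg] := sup_pos g g0 gM Ig0.
set A := sup (range f) in A0 fA supf; set B := sup (range g) in B0 gB supg.
pose C := A `^ (1 - a) * B `^ a.
have C0 : 0 < C by rewrite mulr_gt0// powR_gt0.
have scale_superlevel c (k : R -> R) t : 0 < c ->
    superlevel (fun x => c^-1 * k x) t = superlevel k (c * t).
  move=> c0; apply/seteqP; split => x; rewrite /superlevel/=.
    by rewrite mulrC ltr_pdivlMr// mulrC.
  by rewrite [c^-1 * _]mulrC ltr_pdivlMr// mulrC.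
have scale_int c (k : R -> R) : 0 < c -> (forall t, is_interval (superlevel k t)) ->
    (forall x, 0 <= k x) ->
    (\int[mu]_x (c^-1 * k x)%:E = c^-1%:E * \int[mu]_x (k x)%:E)%E.
  move=> c0 itvk k0; under eq_integral do rewrite EFinM.
  rewrite ge0_integralZl_EFin//; first by move=> x _; rewrite lee_fin.
  - by apply/measurable_EFinP; exact: superlevel_measurable_fun.
  - by rewrite invr_ge0 ltW.
have fin_int (k : R -> R) : (forall x, 0 <= k x) -> \int[mu]_x k x <> 0 ->
    (\int[mu]_x (k x)%:E = (\int[mu]_x k x)%:E)%E.
  move=> k0; rewrite /Rintegral.
  have : (0 <= \int[mu]_x (k x)%:E)%E by apply: integral_ge0 => x _; rewrite lee_fin.
  by case: (\int[mu]_x (k x)%:E)%E.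
have hE : (\int[mu]_x (h x)%:E = (\int[mu]_x h x)%:E)%E.
  rewrite /Rintegral fineK// ge0_fin_numE//.
  by apply: integral_ge0 => x _; rewrite lee_fin.
have := @prekopa_leindler_sup1 a (fun x => A^-1 * f x) (fun x => B^-1 * g x)
  (fun x => C^-1 * h x) a01.
rewrite !scale_int// (fin_int f)// (fin_int g)// hE -!EFinM -EFinD lee_fin.
move=> sup1.
have {sup1} : (1 - a) * (A^-1 * \int[mu]_x f x) + a * (B^-1 * \int[mu]_x g x) <=
    C^-1 * \int[mu]_x h x.
  apply: sup1.
  - by move=> x; rewrite mulr_ge0// invr_ge0 ltW.
  - by move=> x; rewrite mulr_ge0// invr_ge0 ltW.
  - by move=> x; rewrite mulr_ge0// invr_ge0 ltW.
  - by move=> t; rewrite scale_superlevel.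
  - by move=> t; rewrite scale_superlevel.
  - by move=> t; rewrite scale_superlevel.
  - by move=> x; rewrite mulrC ler_pdivrMr// mul1r.
  - by move=> x; rewrite mulrC ler_pdivrMr// mul1r.
  - by move=> t t1; rewrite scale_superlevel//; apply: supf; rewrite gtr_pMr.
  - by move=> t t1; rewrite scale_superlevel//; apply: supg; rewrite gtr_pMr.
  - move=> x y; rewrite !powRM ?invr_ge0 ?(ltW A0) ?(ltW B0)//.
    rewrite -!powR_inv1 ?(ltW A0) ?(ltW B0) ?(ltW C0)// [_ `^ (1 - a)]powRAC.
    rewrite [(B `^ _) `^ a]powRAC.
    rewrite mulrACA -powRM ?powR_ge0// ler_wpM2l ?powR_ge0//; exact: lc.
have I0 (k : R -> R) : (forall x, 0 <= k x) -> 0 <= \int[mu]_x k x.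
  by move=> k0; exact: Rintegral_ge0.
rewrite -(ler_pM2l C0) mulVKf ?gt_eqF//; apply: le_trans.
apply: le_trans (ler_wpM2l (ltW C0) (powR_convex_comb_le a01 _ _)); last 2 first.
- by rewrite mulr_ge0 ?I0// invr_ge0 ltW.
- by rewrite mulr_ge0 ?I0// invr_ge0 ltW.
rewrite /C mulrACA -!powRM ?mulr_ge0 ?invr_ge0 ?(ltW A0) ?(ltW B0) ?I0//.
by rewrite !mulVKf ?gt_eqF.
Qed.

(** [s^-1] times the image of Lebesgue measure under [x |-> s^-1 x] agrees with Lebesgue measure on
    half-open intervals, hence on all measurable sets. *)
Lemma ge0_integral_scale (f : R -> R) (s : R) : 0 < s ->
  measurable_fun setT f -> (forall x, 0 <= f x) ->
  (\int[mu]_x (f (s^-1 * x))%:E = s%:E * \int[mu]_x (f x)%:E)%E.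
Proof.
move=> s0 mf f0.
pose phi (x : R) : measurableTypeR R := s^-1 * x.
have mphi : measurable_fun setT phi by exact: mulrl_measurable.
pose s' : {nonneg R} := NngNum (ltW s0).
rewrite -(@ge0_integral_mscale _ _ R mu setT measurableT s' (EFin \o f))//; last 2 first.
- exact/measurable_EFinP.
- by move=> x _; rewrite lee_fin.
transitivity (\int[pushforward mu phi]_y (f y)%:E)%E.
  rewrite ge0_integral_pushforward//; first exact/measurable_EFinP.
  by move=> y _; rewrite lee_fin.
apply: eq_measure_integral => A mA _.
have sV0 : 0 <= s^-1 by rewrite invr_ge0 ltW.
pose t' : {nonneg R} := NngNum sV0.
pose pmu : {measure set (measurableTypeR R) -> \bar R} :=
  measure_function_pushforward__canonical__measure_function_Measure mu mphi.
transitivity (s%:E * mscale t' pmu A)%E; last first.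
  transitivity (s%:E * mu A)%E; last by [].
  congr (_ * _)%E; apply/esym.
  apply: (@lebesgue_measure_unique _ (mscale t' pmu)) => //.
  move=> _ [[u v]] /= _ <-; rewrite /mscale/= /pmu/= /pushforward.
  rewrite (_ : phi @^-1` _ = `]s * u, s * v]%classic); last first.
    apply/seteqP; split => x /=; rewrite !in_itv/= /phi [s^-1 * x]mulrC ltr_pdivlMr// ler_pdivrMr//.
      by rewrite ![s * _]mulrC.
    by rewrite ![s * _]mulrC.
  rewrite !lebesgue_measure_itv/= !lte_fin ltr_pM2l//.
  case: ifPn => _; last by rewrite mule0.
  by rewrite -!EFinB -EFinM -mulrBr mulKf// gt_eqF.
by rewrite /mscale/= muleA -EFinM divff ?gt_eqF// mul1e.
Qed.

End prekopa_leindler.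

(** * The Brunn-Minkowski inequality for the iterated volume *)

Section volume.
Context {R : realType}.
Let mu := @lebesgue_measure R.

Definition mixes_into n (a : R) (A B C : set 'rV[R]_n) :=
  forall x y, A x -> B y -> C ((1 - a) *: x + a *: y).

Definition is_convex n (A : set 'rV[R]_n) :=
  forall a, 0 < a < 1 -> mixes_into a A A A.

Definition in_cube n (M : R) (A : set 'rV[R]_n) :=
  forall x, A x -> forall i, `|x ord0 i| <= M.

Definition slice n (A : set 'rV[R]_n.+1) (x : R) : set 'rV[R]_n :=
  [set v | A (row_mx x%:M v : 'rV[R]_(1 + n))].

Lemma scale_add_row_mx n (b c x y : R) (v w : 'rV[R]_n) :
  b *: (row_mx x%:M v : 'rV[R]_n.+1) + c *: (row_mx y%:M w : 'rV[R]_n.+1) =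
  row_mx (b * x + c * y)%:M (b *: v + c *: w).
Proof.
have : b *: (row_mx x%:M v : 'rV[R]_(1 + n)) + c *: (row_mx y%:M w : 'rV[R]_(1 + n)) =
    row_mx (b * x + c * y)%:M (b *: v + c *: w).
  by rewrite !scale_row_mx add_row_mx !scale_scalar_mx -raddfD.
exact.
Qed.

Lemma mixes_into_slice n a (A B C : set 'rV[R]_n.+1) x y :
  mixes_into a A B C ->
  mixes_into a (slice A x) (slice B y) (slice C ((1 - a) * x + a * y)).
Proof.
move=> ABC v w Av Bw; have := ABC _ _ Av Bw; rewrite /slice/=.
by rewrite scale_add_row_mx.
Qed.

Lemma is_convex_slice n (A : set 'rV[R]_n.+1) x :
  is_convex A -> is_convex (slice A x).
Proof.
move=> cA a a01; have := @mixes_into_slice n a A A A x x (cA a a01).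
by rewrite -mulrDl subrK mul1r.
Qed.

Lemma in_cube_slice n M (A : set 'rV[R]_n.+1) x :
  in_cube M A -> in_cube M (slice A x).
Proof.
move=> AM v Av i; have := AM _ Av (rshift 1 i).
by rewrite (row_mxEr (x%:M : 'M[R]_(1, 1))).
Qed.

Lemma slice_eq0 n M (A : set 'rV[R]_n.+1) x :
  in_cube M A -> M < `|x| -> slice A x = set0.
Proof.
move=> AM Mx; rewrite -subset0 => v Av; have := AM _ Av (lshift n (ord0 : 'I_1)).
by rewrite (row_mxEl (x%:M : 'M[R]_(1, 1))) mxE eqxx mulr1n leNgt Mx.
Qed.

Lemma volumeS n (A : set 'rV[R]_n.+1) :
  volume A = (\int[mu]_x volume (slice A x))%E.
Proof. by []. Qed.

Lemma volume_ge0 n (A : set 'rV[R]_n) : (0 <= volume A)%E.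
Proof.
elim: n A => [|n IHn] A /=; first by rewrite lee_fin indicE ler0n.
by apply: integral_ge0 => x _; exact: IHn.
Qed.

Lemma volume_set0 n : volume (set0 : set 'rV[R]_n) = 0%E.
Proof.
elim: n => [|n IHn] /=; first by rewrite indicE in_set0.
by apply: integral0_eq => x _; rewrite -[RHS]IHn.
Qed.

(** This and [brunn_minkowski_at] are predicates of the dimension for the sake of a joint induction:
    finiteness in dimension [n + 1] uses measurable slice volumes, which Brunn-Minkowski in
    dimension [n] provides. *)
Definition volume_finite_at n := forall (A : set 'rV[R]_n) M, 0 <= M ->
  is_convex A -> in_cube M A -> (volume A <= ((2 * M) ^+ n)%:E)%E.

(** The multiplicative form accommodates empty slices, whose factor is [0], and its exponents are
    the same in every dimension. *)
Definition brunn_minkowski_at n := forall a (A B C : set 'rV[R]_n) M,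
  0 < a < 1 -> 0 <= M ->
  is_convex A -> is_convex B -> is_convex C ->
  in_cube M A -> in_cube M B -> in_cube M C -> mixes_into a A B C ->
  fine (volume A) `^ (1 - a) * fine (volume B) `^ a <= fine (volume C).

Definition slice_volume n (A : set 'rV[R]_n.+1) x := fine (volume (slice A x)).

Lemma slice_volume_ge0 n (A : set 'rV[R]_n.+1) x : 0 <= slice_volume A x.
Proof. by rewrite fine_ge0// volume_ge0. Qed.

Section slice_volume.
Variables (n : nat) (fin_n : volume_finite_at n) (bm_n : brunn_minkowski_at n).
Variables (M : R) (M0 : 0 <= M).

Lemma slice_volumeE (A : set 'rV[R]_n.+1) x : is_convex A -> in_cube M A ->
  volume (slice A x) = (slice_volume A x)%:E.
Proof.
move=> cA AM; rewrite fineK// ge0_fin_numE ?volume_ge0//.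
apply: le_lt_trans (ltry ((2 * M) ^+ n)).
by apply: fin_n => //; [exact: is_convex_slice|exact: in_cube_slice].
Qed.

Lemma slice_volume_le (A : set 'rV[R]_n.+1) x : is_convex A -> in_cube M A ->
  slice_volume A x <= (2 * M) ^+ n.
Proof.
move=> cA AM; rewrite -lee_fin -slice_volumeE//.
by apply: fin_n => //; [exact: is_convex_slice|exact: in_cube_slice].
Qed.

(** Slices at [x] and [y] mix into the slice at [(1 - a) x + a y], so Brunn-Minkowski in dimension
    [n] is exactly the Prekopa-Leindler hypothesis for slice volumes. *)
Lemma slice_volume_logconcave a (A B C : set 'rV[R]_n.+1) : 0 < a < 1 ->
  is_convex A -> is_convex B -> is_convex C ->
  in_cube M A -> in_cube M B -> in_cube M C -> mixes_into a A B C ->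
  logconcave_triple a (slice_volume A) (slice_volume B) (slice_volume C).
Proof.
move=> a01 cA cB cC AM BM CM ABC x y.
apply: (bm_n a01 M0); do ?[exact: is_convex_slice|exact: in_cube_slice].
exact: mixes_into_slice.
Qed.

Lemma slice_volume_superlevel (A : set 'rV[R]_n.+1) t :
  is_convex A -> in_cube M A -> is_interval (superlevel (slice_volume A) t).
Proof.
move=> cA AM; apply: logconcave_superlevel; first exact: slice_volume_ge0.
by move=> a a01; apply: slice_volume_logconcave => //; exact: cA.
Qed.

Lemma volume_slice_volume (A : set 'rV[R]_n.+1) : is_convex A -> in_cube M A ->
  volume A = (\int[mu]_x (slice_volume A x)%:E)%E.
Proof.
by move=> cA AM; rewrite volumeS; apply: eq_integral => x _; exact: slice_volumeE.
Qed.

End slice_volume.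

Lemma volume_finite_brunn_minkowski n : volume_finite_at n /\ brunn_minkowski_at n.
Proof.
elim: n => [|n [fin_n bm_n]].
  split=> [A M _ _ _|a A B C M /andP[a0 a1] _ _ _ _ _ _ _ ABC] /=.
    by rewrite expr0 lee_fin indicE lern1 leq_b1.
  rewrite !indicE.
  (* In dimension [0] volumes are [0] or [1], and [C] contains the single point as soon as [A] and
     [B] do. *)
  have [A0|A0] := boolP (0 \in A); last by rewrite powR0 ?mul0r// subr_eq0 gt_eqF.
  have [B0|B0] := boolP (0 \in B); last by rewrite powR0 ?mulr0// gt_eqF.
  rewrite !powR1 mul1r mem_set//.
  by have := ABC _ _ (set_mem A0) (set_mem B0); rewrite !scaler0 addr0.
have finS : volume_finite_at n.+1.
  move=> A M M0 cA AM; rewrite (volume_slice_volume fin_n M0)//.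
  have itvA t := slice_volume_superlevel bm_n M0 (t := t) cA AM.
  pose D : set R := `[- M, M]%classic.
  have mD : measurable D by exact: measurable_itv.
  (* Slices outside [[-M, M]] are empty; the others have volume at most [(2 M)^n]. *)
  rewrite [leLHS](_ : _ = \int[mu]_(x in D) (slice_volume A x)%:E)%E; last first.
    rewrite [RHS]integral_mkcond; apply: eq_integral => x _; rewrite patchE.
    case: ifPn => //; rewrite notin_setE /D/= in_itv/= -ler_norml => /negP.
    by rewrite -ltNge => Mx; rewrite /slice_volume (slice_eq0 AM Mx) volume_set0.
  apply: (@le_trans _ _ (\int[mu]_(x in D) (cst ((2 * M) ^+ n)%:E) x)%E).
    apply: ge0_le_integral => //.
    - by move=> x _; rewrite lee_fin slice_volume_ge0.
    - by apply/measurable_EFinP/measurable_funTS; exact: superlevel_measurable_fun.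
    - by move=> x _; rewrite lee_fin (slice_volume_le fin_n).
  rewrite integral_cst// exprSr EFinM lee_pmul//.
    by rewrite lee_fin exprn_ge0// mulr_ge0.
  rewrite [leLHS](lebesgue_measure_itv `[- M, M])/= lte_fin.
  by case: ifPn => _; rewrite lee_fin; lra.
split=> // a A B C M a01 M0 cA cB cC AM BM CM ABC.
have fin_n' := finS _ _ M0 cC CM.
rewrite !(volume_slice_volume fin_n M0)//.
apply: (@prekopa_leindler _ a ((2 * M) ^+ n)) => //.
- exact: slice_volume_ge0.
- exact: slice_volume_ge0.
- exact: slice_volume_ge0.
- by move=> t; exact: (slice_volume_superlevel bm_n M0).
- by move=> t; exact: (slice_volume_superlevel bm_n M0).
- by move=> t; exact: (slice_volume_superlevel bm_n M0).
- by move=> x; exact: (slice_volume_le fin_n).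
- by move=> x; exact: (slice_volume_le fin_n).
- by rewrite -(volume_slice_volume fin_n M0)// (le_lt_trans fin_n') ?ltry.
- exact: (slice_volume_logconcave bm_n M0).
Qed.

Lemma slice_dilation n s (A : set 'rV[R]_n.+1) x : 0 < s ->
  slice (dilation s A) x = dilation s (slice A (s^-1 * x)).
Proof.
move=> s0; have sN0 : s != 0 by rewrite gt_eqF.
have row_scale (y : R) (v : 'rV[R]_n) :
    s *: (row_mx (s^-1 * y)%:M v : 'rV[R]_n.+1) = row_mx y%:M (s *: v).
  have := scale_add_row_mx s 0 (s^-1 * y) 0 v 0.
  by rewrite !scale0r mul0r !addr0 mulVKf.
apply/seteqP; split=> [v [w Aw wv]|v [w Aw <-]].
  exists (s^-1 *: v); last by rewrite scalerA divff// scale1r.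
  rewrite /slice/=; suff -> : row_mx (s^-1 * x)%:M (s^-1 *: v) = w by [].
  by apply: (scalerI sN0); rewrite row_scale scalerA divff// scale1r.
by exists (row_mx (s^-1 * x)%:M w : 'rV[R]_n.+1) => //; rewrite row_scale.
Qed.

(** The slice of [s A] at [x] is [s] times the slice of [A] at [x / s]: induction contributes [s^n]
    and the substitution in [x] the last factor [s]. *)
Lemma volume_dilation n s (A : set 'rV[R]_n) M : 0 < s -> 0 <= M ->
  is_convex A -> in_cube M A ->
  volume (dilation s A) = ((s ^+ n)%:E * volume A)%E.
Proof.
move=> s0 M0; elim: n A => [|n IHn] A cA AM.
  rewrite expr0 mul1e /= !indicE; congr ((nat_of_bool _)%:R%:E).
  apply/idP/idP => /set_mem; last by move=> A0; apply/mem_set; exists 0; rewrite ?scaler0.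
  by case=> x Ax _; apply/mem_set; rewrite (_ : 0 = x)//; apply/rowP => -[].
rewrite volumeS.
have [fin_n bm_n] := volume_finite_brunn_minkowski n.
under eq_integral => x _.
  rewrite slice_dilation// IHn; [|exact: is_convex_slice|exact: in_cube_slice].
  rewrite (slice_volumeE fin_n M0)//.
  over.
have itvA t := slice_volume_superlevel bm_n M0 (t := t) cA AM.
have mA := superlevel_measurable_fun itvA.
rewrite ge0_integralZl_EFin//=; last 3 first.
- by move=> x _; rewrite lee_fin slice_volume_ge0.
- apply/measurable_EFinP; apply: measurableT_comp => //; exact: mulrl_measurable.
- by rewrite exprn_ge0 ?ltW.
rewrite (ge0_integral_scale s0 mA); last exact: slice_volume_ge0.
by rewrite muleA -EFinM -exprSr -(volume_slice_volume fin_n M0).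
Qed.

End volume.

(** * The Gamma function at half-integers *)

Section gamma.
Context {R : realType}.
Let mu := @lebesgue_measure R.
Local Notation D := (`[0%R, +oo[%classic : set R).

Let mD : measurable D. Proof. exact: measurable_itv. Qed.

Lemma integral_expRN_itvcy (b : R) :
  (\int[mu]_(t in `[b, +oo[) (expR (- t))%:E = (expR (- b))%:E)%E.
Proof.
have dF (x : R) : is_derive x 1 (fun t : R => - expR (- t)) (expR (- x)).
  apply: is_derive_eq.  by rewrite mulrN1 opprK.
have cE : continuous (fun t : R => expR (- t)).
  move=> x; apply: continuous_comp; first exact: continuousN.
  exact: continuous_expR.
rewrite (@ge0_continuous_FTC2y _ (fun t => expR (- t)) (fun t => - expR (- t)) b 0).
- by rewrite -EFinB sub0r opprK.
- by move=> x _; exact: expR_ge0.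
- exact: continuous_subspaceT.
- by rewrite -oppr0; apply: cvgN; exact: cvgr_expR.
- by move=> x _; exact: ex_derive.
- by apply: cvg_at_right_filter; apply: cvgN; exact: cE.
- by move=> x _; rewrite derive1E derive_val.
Qed.

(* Writes [e^(-phi u)] as the integral of [e^(-t)] over [t >= phi u]; both the recursion
   of Gamma ([phi = id]) and its value at 3/2 ([phi u = u^2]) come from this. *)
Lemma tonelli_expRN (w phi : R -> R) :
  measurable_fun setT w -> measurable_fun setT phi ->
  (forall u, 0 <= u -> 0 <= w u) -> (forall u, 0 <= u -> 0 <= phi u) ->
  (\int[mu]_(u in D) (w u * expR (- phi u))%:E =
   \int[mu]_(t in D) ((expR (- t))%:E *
     \int[mu]_(u in D `&` [set u | (phi u <= t)%R]) (w u)%:E))%E.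
Proof.
move=> mw mphi w0 phi0.
pose GR := measurableTypeR R.
pose G (p : GR * GR) := \1_D p.1 * w p.1 * (\1_`[phi p.1, +oo[ p.2 * expR (- p.2)).
have G0 p : 0 <= G p.
  rewrite /G; apply: mulr_ge0; last by rewrite mulr_ge0 ?expR_ge0.
  rewrite indicE; case: (boolP (p.1 \in D)); last by rewrite mul0r.
  by rewrite inE/= in_itv/= andbT mul1r; exact: w0.
have mle : measurable [set p : GR * GR | phi p.1 <= p.2].
  have : measurable_fun setT (fun p : GR * GR => (phi p.1 <= p.2)%R).
    by apply: measurable_fun_ler => //; exact: measurableT_comp.
  by move=> /(_ measurableT [set true]); rewrite setTI; exact.
have mG : measurable_fun setT G.
  apply: measurable_funM; apply: measurable_funM.
  - have mI : measurable_fun setT (\1_D : GR -> R) by exact: measurable_indic.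
    exact: (measurableT_comp mI).
  - exact: measurableT_comp.
  - rewrite (_ : (fun p : GR * GR => _) = \1_[set p : GR * GR | phi p.1 <= p.2]).
      exact: measurable_indic.
    apply/funext => p; rewrite !indicE; congr (nat_of_bool _)%:R.
    by apply/idP/idP; rewrite !inE/= in_itv/= andbT.
  - apply: measurableT_comp => //; exact: measurableT_comp.
transitivity (\int[mu]_u \int[mu]_t (G (u, t))%:E)%E.
  rewrite [LHS]integral_mkcond; apply: eq_integral => u _; rewrite patchE.
  case: ifPn => [uD|uD]; last first.
    by rewrite integral0_eq// => t _; rewrite /G/= indicE (negbTE uD) !mul0r.
  have u0 : 0 <= u by move: uD; rewrite inE/= in_itv/= andbT.
  rewrite EFinM -integral_expRN_itvcy -ge0_integralZl_EFin ?w0//; last first.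
    by apply/measurable_EFinP/measurable_funTS; exact: measurableT_comp.
  rewrite integral_mkcond; apply: eq_integral => t _; rewrite patchE /G/=.
  rewrite indicE uD mul1r indicE.
  by case: ifPn => // _; rewrite ?mul1r ?mul0r ?mulr0 -?EFinM.
rewrite (fubini_tonelli (m1 := mu) (m2 := mu) (EFin \o G))//=; last first.
  exact/measurable_EFinP.
rewrite [RHS]integral_mkcond; apply: eq_integral => t _; rewrite patchE.
have mphit : measurable (D `&` [set u | phi u <= t]).
  apply: measurableI => //.
  have : measurable_fun setT (fun u : GR => (phi u <= t)%R) by exact: measurable_fun_ler.
  by move=> /(_ measurableT [set true]); rewrite setTI; exact.
case: ifPn => [tD|tD]; last first.
  apply: integral0_eq => u _; rewrite /G/= !indicE.
  case: (boolP (u \in D)) => [uD|_]; last by rewrite !mul0r.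
  rewrite [_ \in `[phi u, +oo[%classic]memNset ?mul0r ?mulr0//=.
  rewrite in_itv/= andbT => pt; move/negP: tD; apply; rewrite inE/= in_itv/= andbT.
  by rewrite (le_trans _ pt)// phi0//; move: uD; rewrite inE/= in_itv/= andbT.
rewrite -ge0_integralZl_EFin//; last 2 first.
- by move=> u [/=]; rewrite in_itv/= andbT lee_fin => /w0.
- by apply/measurable_EFinP/measurable_funTS.
rewrite [RHS]integral_mkcond; apply: eq_integral => u _; rewrite patchE /G/=.
rewrite in_setI !indicE (_ : (t \in _) = (u \in [set u | phi u <= t])); last first.
  by apply/idP/idP; rewrite !inE/= in_itv/= andbT.
case: (u \in D) => /=; last by rewrite !mul0r.
by case: (u \in _) => /=; rewrite ?mul1r ?mul0r ?mulr0// -EFinM mulrC.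
Qed.

(* Extended-real valued, so that its recursion needs no integrability. *)
Definition eGamma (x : R) : \bar R :=
  (\int[mu]_(t in D) (t `^ (x - 1) * expR (- t))%:E)%E.

Lemma Gamma_eGamma x : Gamma x = fine (eGamma x).
Proof.
rewrite /Gamma /Rintegral; congr fine; rewrite integral_itv_obnd_cbnd//.
apply/measurable_EFinP/measurable_funTS/measurable_funM.
  exact: measurable_powR.
by apply: measurableT_comp => //; exact: measurableT_comp.
Qed.

Lemma eGamma1 : eGamma 1 = 1%E.
Proof.
rewrite /eGamma -[RHS](_ : (expR (- 0))%:E = 1%E); last by rewrite oppr0 expR0.
rewrite -integral_expRN_itvcy; apply: eq_integral => t _.
by rewrite subrr powRr0 mul1r.
Qed.

Lemma powR_derivable_LRcontinuous (p t : R) : 0 < p -> 0 < t ->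
  derivable_oo_LRcontinuous (@powR R ^~ p) 0 t.
Proof.
move=> p0 t0; have d (u : R) : 0 < u -> derivable (@powR R ^~ p) u 1.
  by move=> u0; apply: derivable_powR; rewrite in_itv/= u0.
split.
- by move=> u; rewrite in_itv/= => /andP[u0 _]; exact: d.
- by rewrite powR0 ?gt_eqF//; exact: powR_cvg0.
- apply: cvg_at_left_filter; have : {for t, continuous (@powR R ^~ p)}.
    by apply/differentiable_continuous/derivable1_diffP; exact: d.
  exact.
Qed.

Lemma integral_powR (p t : R) : 1 <= p -> 0 <= t ->
  (\int[mu]_(u in `[0%R, t]) (p * u `^ (p - 1))%:E = (t `^ p)%:E)%E.
Proof.
move=> p1; rewrite le_eqVlt => /predU1P[<-|t0].
  by rewrite set_itv1 integral_set1 powR0// gt_eqF// (lt_le_trans ltr01).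
have p0 : 0 < p := lt_le_trans ltr01 p1.
rewrite (continuous_FTC2 t0 _ (powR_derivable_LRcontinuous p0 t0)).
- by rewrite powR0 ?gt_eqF// sube0.
- move=> u; apply: cvgM; first exact: cvg_cst.
  (* For [p = 1] this factor is constantly [1], also at the origin, since [0] to the power [0] is
     [1]. *)
  move: p1 u; rewrite le_eqVlt => /predU1P[<-|p1].
    rewrite subrr.
    by move=> v; under eq_cvg do rewrite powRr0; rewrite powRr0; exact: cvg_cst.
  apply: derivable_oo_LRcontinuous_within.
  by apply: powR_derivable_LRcontinuous => //; rewrite subr_gt0.
- move=> u; rewrite in_itv/= => /andP[u0 _].
  by rewrite powR_derive1// in_itv/= u0.
Qed.

(** With [w u = x u^(x - 1)] and [phi = id] in [tonelli_expRN], the inner integral is [t^x]; Tonelli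
    takes the place of integration by parts. *)
Lemma eGammaS x : 1 <= x -> eGamma (x + 1) = (x%:E * eGamma x)%E.
Proof.
move=> x1; have x0 : 0 <= x := le_trans ler01 x1.
rewrite /eGamma -ge0_integralZl_EFin//; last 2 first.
- by move=> t _; rewrite lee_fin mulr_ge0 ?powR_ge0 ?expR_ge0.
- apply/measurable_EFinP/measurable_funTS/measurable_funM.
    exact: measurable_powR.
  by apply: measurableT_comp => //; exact: measurableT_comp.
under [RHS]eq_integral do rewrite -EFinM mulrA.
rewrite (@tonelli_expRN (fun t => x * t `^ (x - 1)) id)//; last 2 first.
- by apply: measurable_funM => //; exact: measurable_powR.
- by move=> u _; rewrite mulr_ge0 ?powR_ge0.
apply: eq_integral => t /set_mem/=; rewrite in_itv/= andbT => t0.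
rewrite (_ : D `&` _ = `[0, t]%classic).
  by rewrite integral_powR// -EFinM mulrC addrK.
by apply/seteqP; split=> u /=; rewrite !in_itv/= andbT; [case=> -> ->|case/andP].
Qed.

(** The right side is the Gaussian integral over the half-line. With [w = 1] and [phi u = u^2], the
    inner integral is the length [sqrt t] of the set where [u >= 0] and [u^2 <= t]. *)
Lemma eGamma_3half : eGamma (3 / 2) = (Num.sqrt pi / 2)%:E.
Proof.
rewrite -integral0y_gauss.
under eq_integral do rewrite /gauss_fun -[expR _]mul1r.
rewrite (@tonelli_expRN (fun=> 1) (fun u => u ^+ 2))//; last first.
  by move=> u _; exact: sqr_ge0.
apply: eq_integral => t /set_mem/=; rewrite in_itv/= andbT => t0.
rewrite (_ : D `&` _ = `[0, Num.sqrt t]%classic); last first.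
  apply/seteqP; split=> u /=; rewrite !in_itv/= ?andbT.
    by case=> u0 ut; rewrite u0 -(ger0_norm u0) -sqrtr_sqr ler_wsqrtr.
  case/andP=> u0 ut; split => //.
  by rewrite -(sqr_sqrtr t0) lerXn2r// ?nnegrE ?sqrtr_ge0.
rewrite integral_cst// mul1e.
rewrite (_ : 3 / 2 - 1 = 2^-1 :> R); last by field.
rewrite powR12_sqrt// mulrC EFinM; congr (_ * _)%E.
rewrite [RHS](lebesgue_measure_itv `[0, Num.sqrt t])/= lte_fin.
by case: ltgtP (sqrtr_ge0 t) => // [_ _|<- _]; rewrite ?sube0.
Qed.

End gamma.

(** * Volumes of unit balls and moments of the exponential weight *)

Section constants.
Context {R : realType}.
Let mu := @lebesgue_measure R.
Local Notation D := (`[0%R, +oo[%classic : set R).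

(** The recursion advances [j] by two, so the induction carries all [j <= k], starting from the
    values at [1] and [3 / 2]. *)
Lemma eGamma_half_integer (j : nat) :
  eGamma (1 + j%:R / 2) = (Gamma (1 + j%:R / 2) : R)%:E /\
  0 < Gamma (1 + j%:R / 2 : R).
Proof.
suff H k : forall j, (j <= k)%N ->
    exists2 g : R, 0 < g & eGamma (1 + j%:R / 2) = g%:E.
  by have [g g0 gE] := H j j (leqnn _); rewrite Gamma_eGamma gE.
elim: k => [|k IHk] {}j.
  rewrite leqn0 => /eqP ->; exists 1; first exact: ltr01.
  by rewrite mul0r addr0 eGamma1.
case: j => [_|[_|j jk]]; first exact: IHk.
  exists (Num.sqrt pi / 2); first by rewrite divr_gt0// sqrtr_gt0 pi_gt0.
  by rewrite -eGamma_3half; congr eGamma; field.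
have [g g0 gE] := IHk j (ltnW jk).
exists ((1 + j%:R / 2) * g); first by rewrite mulr_gt0// ltr_wpDr// divr_ge0.
rewrite EFinM -gE -eGammaS ?lerDl ?divr_ge0//; congr eGamma.
by rewrite -!natr1; field.
Qed.

Lemma GammaSS (j : nat) :
  Gamma (1 + j.+2%:R / 2) = (1 + j%:R / 2) * Gamma (1 + j%:R / 2) :> R.
Proof.
apply: EFin_inj; rewrite EFinM -!(eGamma_half_integer _).1.
rewrite -eGammaS ?lerDl ?divr_ge0//; congr eGamma.
by rewrite -!natr1; field.
Qed.

Lemma eGamma_nat (j : nat) : eGamma (1 + j%:R) = (j`!%:R : R)%:E.
Proof.
elim: j => [|j IHj]; first by rewrite addr0 eGamma1 fact0.
rewrite -natr1 addrA eGammaS ?lerDl// IHj -EFinM; congr EFin.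
by rewrite factS natrM -natr1 addrC.
Qed.

Lemma kappa_gt0 j : 0 < kappa R j.
Proof. by rewrite divr_gt0 ?powR_gt0 ?pi_gt0// (eGamma_half_integer j).2. Qed.

Lemma omega_gt0 j : 0 < omega R j.+1.
Proof. by rewrite mulr_gt0 ?ltr0Sn ?kappa_gt0. Qed.

Lemma kappaSS j : kappa R j.+2 = kappa R j * pi / (1 + j%:R / 2).
Proof.
rewrite /kappa GammaSS (_ : j.+2%:R / 2 = j%:R / 2 + 1); last first.
  by rewrite -!natr1; field.
rewrite powRD; last by rewrite (gt_eqF (pi_gt0 R)) implybT.
rewrite powRr1 ?pi_ge0// invfM; ring.
Qed.

(** Legendre's duplication formula in terms of ball volumes. The product of neighbours permits a
    one-step induction although [kappaSS] moves by two, so no parity cases arise. *)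
Lemma kappa_mul j :
  kappa R j * kappa R j.+1 * j.+1`!%:R = 2 * (2 * pi) ^+ j.
Proof.
elim: j => [|j IHj].
  rewrite /kappa !mul0r powRr0 addr0 Gamma_eGamma eGamma1 divr1 mul1r.
  rewrite (_ : 1 + 1 / 2 = 3 / 2 :> R); last by field.
  rewrite Gamma_eGamma eGamma_3half/= mul1r powR12_sqrt ?pi_ge0// expr0 (_ : 1`! = 1%N)//.
  by field; rewrite gt_eqF// sqrtr_gt0 pi_gt0.
rewrite kappaSS exprS.
have -> : 2 * (2 * pi * (2 * pi) ^+ j) = 2 * pi * (2 * (2 * pi) ^+ j) :> R by ring.
rewrite -IHj factS natrM -[j.+2%:R]natr1 -[j.+1%:R]natr1.
by field; rewrite ?gt_eqF// ltr_wpDl.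
Qed.

(** This matches the two normalizations: the moment [j!] of the exponential weight turns Steiner's
    constant [kappa_j] into the [1 / omega_(j+1)] of the rotation volumes, up to powers of [2 pi]
    and a constant. *)
Lemma kappa_factorial j :
  kappa R j * j`!%:R = 2 * (2 * pi) ^+ j / omega R j.+1.
Proof.
rewrite -kappa_mul factS natrM /omega; field.
by rewrite (gt_eqF (kappa_gt0 _)) addrC natr1 pnatr_eq0.
Qed.

Lemma integral_monomial_expRN (k : nat) :
  (\int[mu]_(l in D) (l ^+ k * expR (- l))%:E = (k`!%:R)%:E)%E.
Proof.
rewrite -eGamma_nat; apply: eq_integral => l /set_mem/=.
by rewrite in_itv/= andbT => l0; rewrite addrAC subrr add0r powR_mulrn.
Qed.

Lemma integrable_monomial_expRN (k : nat) (c : R) :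
  mu.-integrable D (EFin \o (fun l => c * (l ^+ k * expR (- l)))).
Proof.
rewrite (_ : EFin \o _ = (fun l => c%:E * (l ^+ k * expR (- l))%:E)%E)//.
apply: integrableZl => //; apply/integrableP; split.
  apply/measurable_EFinP/measurable_funTS/measurable_funM.
    exact: exprn_measurable.
  by apply: measurableT_comp => //; exact: measurableT_comp.
rewrite (_ : integral _ _ _ = (k`!%:R)%:E) ?ltry// -integral_monomial_expRN.
apply: eq_integral => l /set_mem/=; rewrite in_itv/= andbT => l0.
by rewrite ger0_norm// mulr_ge0 ?exprn_ge0 ?expR_ge0.
Qed.

Lemma polynomial_expRN_Rintegral (I : Type) (r : seq I) (c : I -> R) (k : I -> nat) :
  mu.-integrable D (EFin \o
    (fun l => \sum_(i <- r) c i * (l ^+ k i * expR (- l)))) /\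
  \int[mu]_(l in D) (\sum_(i <- r) c i * (l ^+ k i * expR (- l))) =
  \sum_(i <- r) c i * (k i)`!%:R.
Proof.
elim: r => [|i r [intr IHr]].
  have -> : (fun l => \sum_(i <- [::]) c i * (l ^+ k i * expR (- l))) = cst 0.
    by apply/funext => l; rewrite big_nil.
  by rewrite big_nil Rintegral_cst// mul0r; split=> //; exact: integrable0.
split.
  rewrite (_ : EFin \o _ = (EFin \o (fun l => (c i * (l ^+ k i * expR (- l)))%R)) \+
      (EFin \o (fun l => (\sum_(i <- r) c i * (l ^+ k i * expR (- l)))%R)))%E.
    by apply: integrableD => //; exact: integrable_monomial_expRN.
  by apply/funext => l /=; rewrite big_cons EFinD.
under eq_Rintegral do rewrite big_cons.
rewrite RintegralD//; last exact: integrable_monomial_expRN.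
rewrite IHr big_cons RintegralZl//; last first.
  apply: eq_integrable (integrable_monomial_expRN (k i) 1) => // l _ /=.
  by rewrite mul1r.
by rewrite {1}/Rintegral integral_monomial_expRN.
Qed.

End constants.

(** * Generating functions and Bernstein's inequality *)

Section generating_function.
Context {R : realType}.

Lemma ge0_of_derive_ge0 (f df : R -> R) (b : R) :
  (forall x : R, is_derive x 1 f (df x)) -> f 0 = 0 ->
  (forall x, 0 <= x <= b -> 0 <= df x) -> 0 <= b -> 0 <= f b.
Proof.
move=> Df f0 df0 b0.
have cf : continuous f.
  by move=> x; apply/differentiable_continuous/derivable1_diffP; exact: ex_derive.
have [c cb] := MVT_segment b0 (fun x _ => Df x) (continuous_subspaceT cf).
by rewrite f0 !subr0 => ->; rewrite mulr_ge0// df0.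
Qed.

(** Once the denominator is cleared, two differentiations reduce the claim to [1 - z <= e^(-z)]. *)
Lemma expR_bernstein (x : R) : 0 <= x < 3 ->
  expR x - 1 - x <= x ^+ 2 / 2 / (1 - x / 3).
Proof.
move=> /andP[x0 x3].
have x3' : 0 < 1 - x / 3 by rewrite subr_gt0 ltr_pdivrMr// mul1r.
rewrite ler_pdivlMr// -subr_ge0.
have D1 (y : R) : is_derive y 1
    (fun y => (2 + y) - expR y * (2 - y)) (1 - expR y * (1 - y)).
  by apply: is_derive_eq; rewrite /GRing.scale/=; ring.
have D2 (y : R) : is_derive y 1
    (fun y => y ^+ 2 / 2 - (expR y - 1 - y) * (1 - y / 3))
    (((2 + y) - expR y * (2 - y)) / 3).
  by apply: is_derive_eq; rewrite /GRing.scale/=; field.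
apply: (ge0_of_derive_ge0 D2) => //; first by rewrite expR0; field.
move=> y /andP[y0 _]; rewrite divr_ge0//.
apply: (ge0_of_derive_ge0 D1) => //; first by rewrite expR0; ring.
move=> z _; rewrite subr_ge0 -ler_pdivlMl ?expR_gt0// mulr1 -expRN.
exact: expR_ge1Dx.
Qed.

(** Lets the lower tail share the estimate of the upper one. The derivative of the difference is the
    square of [e^(y/2) - e^(-y/2)]. *)
Lemma expRN_le_expR (x : R) : 0 <= x -> expR (- x) - 1 + x <= expR x - 1 - x.
Proof.
move=> x0; rewrite -subr_ge0.
have D1 (y : R) : is_derive y 1
    (fun y => expR y - 1 - y - (expR (- y) - 1 + y)) (expR y + expR (- y) - 2).
  by apply: is_derive_eq; rewrite /GRing.scale/=; ring.
apply: (ge0_of_derive_ge0 D1) => //; first by rewrite oppr0; ring.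
move=> y _; have := sqr_ge0 (expR (y / 2) - expR (- (y / 2))).
rewrite sqrrB -!expRM_natr -expRD subrr expR0 !mulNr !divfK// ?pnatr_eq0//; lra.
Qed.

(** A second-order bound at [1] stands in for the derivative of the generating function there. *)
Lemma exprD1_le (i : nat) : exists2 C : R, 0 <= C &
  forall h, `|h| <= 1 -> (1 + h) ^+ i <= 1 + i%:R * h + C * h ^+ 2.
Proof.
elim: i => [|i [C C0 IHi]]; first by exists 0 => // h _; rewrite expr0; lra.
(* Multiplying the bound for [i] by [1 + h] leaves the remainder [(i + C) h^2 + C h^3], where
   [h^3 <= h^2]. *)
exists (i%:R + 2 * C) => [|h h1]; first by rewrite addr_ge0// mulr_ge0.
have /andP[hm hp] : -1 <= h <= 1 by rewrite -ler_norml.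
rewrite exprSr; apply: (@le_trans _ _ ((1 + i%:R * h + C * h ^+ 2) * (1 + h))).
  by rewrite ler_wpM2r ?IHi//; lra.
rewrite -natr1 -subr_ge0.
suff : 0 <= C * h ^+ 2 * (1 - h) by lra.
by apply: mulr_ge0; [rewrite mulr_ge0 ?sqr_ge0|rewrite subr_ge0].
Qed.

(** * Tail bounds from a sub-Poissonian generating function *)

Section pgf.
Variables (n : nat) (p : 'I_n.+1 -> R).
Hypotheses (p0 : forall i, 0 <= p i) (p1 : \sum_i p i = 1).

Definition pgf (s : R) := \sum_(i < n.+1) p i * s ^+ i.
Definition pgf_mean := \sum_(i < n.+1) i%:R * p i.

Lemma pgf_gt0 s : 0 < s -> 0 < pgf s.
Proof.
move=> s0; have G0 : 0 <= pgf s.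
  by apply: sumr_ge0 => i _; rewrite mulr_ge0// exprn_ge0// ltW.
rewrite lt_neqAle G0 andbT eq_sym; apply/eqP => /psumr_eq0P pi0.
have := oner_neq0 R; rewrite -p1 big1 ?eqxx// => i _.
have /eqP := pi0 (fun i _ => mulr_ge0 (p0 i) (exprn_ge0 i (ltW s0))) i isT.
by rewrite mulf_eq0 expf_eq0 (gt_eqF s0) andbF orbF => /eqP.
Qed.

Lemma pgfD1_le : exists2 C : R, 0 <= C &
  forall h, `|h| <= 1 -> pgf (1 + h) <= 1 + pgf_mean * h + C * h ^+ 2.
Proof.
have /choice[C HC] (i : 'I_n.+1) : exists C : R, 0 <= C /\
    forall h, `|h| <= 1 -> (1 + h) ^+ i <= 1 + i%:R * h + C * h ^+ 2.
  by have [C] := exprD1_le i; exists C.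
exists (\sum_i p i * C i); first by apply: sumr_ge0 => i _; rewrite mulr_ge0// (HC i).1.
move=> h h1; rewrite -[X in _ <= X + _ + _]p1 !mulr_suml -!big_split/=; apply: ler_sum => i _.
by apply: le_trans (ler_wpM2l (p0 i) ((HC i).2 h h1)) _; lra.
Qed.

(* The graph of the concave function ln pgf lies below its tangent line at 1. *)
Lemma pgf_le_poisson s : 0 < s ->
  (forall a, 0 < a < 1 -> pgf s `^ a <= pgf (1 + a * (s - 1))) ->
  pgf s <= expR (pgf_mean * (s - 1)).
Proof.
move=> s0 lc; have Gs := pgf_gt0 s0.
rewrite -[leLHS]lnK ?posrE// ler_expR; apply/ler_addgt0Pr => e e0.
have [C C0 HC] := pgfD1_le.
(* [K] is so large that [a = 1 / K] satisfies [a < 1] and [|a h| <= 1], and that the remainder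
   [C (a h)^2], multiplied back by [K], is at most [e]. *)
pose h := s - 1; pose K := 2 + `|h| + C * h ^+ 2 / e.
have K1 : 1 < K.
  suff : 0 <= `|h| + C * h ^+ 2 / e by rewrite /K; lra.
  by rewrite addr_ge0// divr_ge0 ?(ltW e0)// mulr_ge0// sqr_ge0.
have K0 : 0 < K by lra.
have hK : `|h| <= K.
  by rewrite /K addrAC lerDr addr_ge0// divr_ge0 ?(ltW e0)// mulr_ge0// sqr_ge0.
have CK : C * h ^+ 2 <= e * K.
  rewrite -ler_pdivrMl// mulrC /K lerDr; have := normr_ge0 h; lra.
have a01 : 0 < K^-1 < 1 by rewrite invr_gt0 K0 invf_lt1.
have Kh : `|K^-1 * h| <= 1.
  by rewrite normrM gtr0_norm ?invr_gt0// mulrC ler_pdivrMr// mul1r.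
have := le_trans (lc _ a01) (HC _ Kh).
rewrite -addrA => /le_trans/(_ (expR_ge1Dx _)).
rewrite /powR gt_eqF// ler_expR -/h -(ler_pM2l K0) mulVKf ?gt_eqF// => /le_trans.
apply; rewrite mulrDr lerD//.
  by rewrite (_ : K * _ = pgf_mean * h)//; field; rewrite gt_eqF.
have -> : K * (C * (K^-1 * h) ^+ 2) = C * h ^+ 2 / K.
  by rewrite exprMn; field; rewrite gt_eqF.
by rewrite ler_pdivrMr.
Qed.

Hypothesis pgf_le : forall s, 0 < s -> pgf s <= expR (pgf_mean * (s - 1)).

Lemma pgf_mean_ge0 : 0 <= pgf_mean.
Proof. by apply: sumr_ge0 => i _; rewrite mulr_ge0. Qed.

(** On the event each [e^(x i + c)] is at least [1], so the mass is bounded by the full exponential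
    moment. The sign of [x] is free, which serves both tails. *)
Lemma chernoff (x c : R) (P : pred 'I_n.+1) :
  (forall i : 'I_n.+1, P i -> 0 <= x * i%:R + c) ->
  \sum_(i | P i) p i <= expR (pgf_mean * (expR x - 1) + c).
Proof.
move=> xc; rewrite expRD.
apply: (@le_trans _ _ (pgf (expR x) * expR c)); last first.
  by rewrite ler_wpM2r ?expR_ge0// pgf_le ?expR_gt0.
rewrite /pgf mulr_suml [leRHS](bigID P)/=; apply: ler_wpDr.
  by apply: sumr_ge0 => i _; rewrite !mulr_ge0 ?exprn_ge0 ?expR_ge0.
apply: ler_sum => i /xc xi; rewrite -mulrA ler_peMr//.
by rewrite -expRM_natr -expRD -[leLHS]expR0 ler_expR.
Qed.

Lemma bernstein_concentration t : 0 <= t ->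
  \sum_(i < n.+1 | t <= `|i%:R - pgf_mean|) p i <=
  2 * expR ((- t ^+ 2 / 2) / (pgf_mean + t / 3)).
Proof.
move=> t0; set d := pgf_mean; have d0 := pgf_mean_ge0; rewrite -/d in d0.
move: d0; rewrite le_eqVlt => /predU1P[d0|d0].
  (* Mean [0] puts all mass at [0]. If moreover [t = 0], the exponent [0 / 0] is [0] and the bound
     [2] exceeds the total mass. *)
  move: t0; rewrite le_eqVlt => /predU1P[<-|t0].
    rewrite expr0n/= oppr0 !mul0r expR0 mulr1.
    apply: (@le_trans _ _ 1); last lra.
    by rewrite -[leRHS]p1 [leRHS](bigID (fun i : 'I_n.+1 => 0 <= `|i%:R - d|))/= lerDl sumr_ge0.
  rewrite big1; first by rewrite mulr_ge0 ?expR_ge0.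
  move=> i; rewrite -d0 subr0 normr_nat => ti.
  have sum0 : \sum_(j < n.+1) j%:R * p j = 0 by [].
  have /(_ i isT)/eqP := psumr_eq0P (fun (j : 'I_n.+1) _ => mulr_ge0 (ler0n _ j) (p0 j)) sum0.
  by rewrite mulf_eq0 => /orP[/eqP i0|/eqP//]; move: ti; rewrite i0 leNgt t0.
have dt0 : 0 < d + t / 3 by rewrite ltr_wpDr// divr_ge0.
(* Bernstein's choice: [1 - x / 3] becomes [d / (d + t / 3)], and the estimate for the exponent is
   then exactly the right side of [key]. *)
pose x := t / (d + t / 3).
have x0 : 0 <= x by rewrite divr_ge0// ltW.
have x3 : x < 3 by rewrite /x ltr_pdivrMr//; lra.
have key : d * (expR x - 1 - x) - x * t <= (- t ^+ 2 / 2) / (d + t / 3).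
  apply: (@le_trans _ _ (d * (x ^+ 2 / 2 / (1 - x / 3)) - x * t)).
    by rewrite lerD2r ler_wpM2l ?(ltW d0)// expR_bernstein// x0.
  have -> : 1 - x / 3 = d / (d + t / 3) by rewrite /x; field; rewrite ?gt_eqF//; lra.
  rewrite le_eqVlt; apply/orP; left; apply/eqP; rewrite /x; field.
  by rewrite !gt_eqF//; lra.
have split_event (i : 'I_n.+1) : t <= `|i%:R - d| =
    (t <= i%:R - d) || (~~ (t <= i%:R - d) && (t <= d - i%:R)).
  by rewrite ler_normr opprB; case: (t <= i%:R - d).
apply: (@le_trans _ _ (\sum_(i < n.+1 | t <= i%:R - d) p i +
    \sum_(i < n.+1 | t <= d - i%:R) p i)).
  rewrite (bigID (fun i : 'I_n.+1 => t <= i%:R - d))/= lerD//.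
    rewrite le_eqVlt; apply/orP; left; apply/eqP; apply: eq_bigl => i.
    by rewrite split_event; case: (t <= i%:R - d); rewrite ?andbF ?andbT.
  rewrite [leRHS](bigID (fun i : 'I_n.+1 => t <= i%:R - d))/= ler_wpDl ?sumr_ge0//.
  rewrite le_eqVlt; apply/orP; left; apply/eqP; apply: eq_bigl => i.
  by rewrite split_event; case: (t <= i%:R - d); rewrite ?andbF ?andbT.
rewrite mulr_natl mulr2n lerD//.
  apply: (le_trans (@chernoff x (- (x * (d + t))) _ _)).
    by move=> i ti; rewrite -mulrBr mulr_ge0//; lra.
  by rewrite ler_expR -/d; lra.
(* The lower tail uses [- x]; [expRN_le_expR] leads its exponent back to [key]. *)
apply: (le_trans (@chernoff (- x) (x * (d - t)) _ _)).
  by move=> i ti; rewrite mulNr addrC -mulrBr mulr_ge0//; lra.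
rewrite ler_expR -/d; apply: le_trans key.
have := ler_wpM2l (ltW d0) (expRN_le_expR x0); lra.
Qed.

End pgf.
End generating_function.

(** * Parallel bodies *)

Section parallel_bodies.
Context {R : realType}.
Let mu := @lebesgue_measure R.
Local Notation D := (`[0%R, +oo[%classic : set R).
Variable n : nat.
Implicit Types K A B : set 'rV[R]_n.

Lemma convex_set_is_convex K : convex_set K -> is_convex K.
Proof.
move=> cK a /andP[a0 a1] x y Kx Ky.
have b0 : 0 <= 1 - a by rewrite subr_ge0 ltW.
have b1 : 1 - a <= 1 by rewrite gerBl ltW.
rewrite -[X in _ + X *: y](subKr 1 a).
exact: set_mem (cK x y (Itv01 b0 b1) (mem_set Kx) (mem_set Ky)).
Qed.

(** After division by [u + v] this is convexity; zero weights are set apart because [is_convex]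
    speaks of [0 < a < 1] only. *)
Lemma is_convex_cone K u v x y : is_convex K -> 0 <= u -> 0 <= v ->
  K x -> K y -> exists2 z, K z & u *: x + v *: y = (u + v) *: z.
Proof.
move=> cK; rewrite le_eqVlt => /predU1P[<- _ _ Ky|u0].
  by exists y => //; rewrite scale0r !add0r.
rewrite le_eqVlt => /predU1P[<- Kx _|v0 Kx Ky].
  by exists x => //; rewrite scale0r !addr0.
have uv0 : 0 < u + v by rewrite addr_gt0.
exists ((1 - v / (u + v)) *: x + (v / (u + v)) *: y).
  by apply: cK => //; rewrite divr_gt0//= ltr_pdivrMr// mul1r ltrDr.
rewrite scalerDr !scalerA; congr (_ *: _ + _ *: _); field; exact: lt0r_neq0.
Qed.

Lemma euclidean_unit_ballP (x : 'rV[R]_n) :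
  euclidean_unit_ball x <-> \sum_(i < n) x ord0 i ^+ 2 <= 1.
Proof.
have s0 : 0 <= \sum_(i < n) x ord0 i ^+ 2 by apply: sumr_ge0 => i _; exact: sqr_ge0.
rewrite /euclidean_unit_ball/= -{1}[1]sqrtr1; split=> [|/ler_wsqrtr//].
by rewrite ler_sqrt.
Qed.

Lemma euclidean_unit_ball_convex : is_convex (@euclidean_unit_ball R n).
Proof.
move=> a /andP[a0 a1] x y /euclidean_unit_ballP x1 /euclidean_unit_ballP y1.
apply/euclidean_unit_ballP.
apply: (@le_trans _ _ ((1 - a) * \sum_(i < n) x ord0 i ^+ 2 +
    a * \sum_(i < n) y ord0 i ^+ 2)); last nra.
rewrite !mulr_sumr -big_split/=; apply: ler_sum => i _; rewrite !mxE.
(* Convexity of the square: the gap equals [a (1 - a) (x_i - y_i)^2]. *)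
rewrite -subr_ge0; apply: (@le_trans _ _ (a * (1 - a) * (x ord0 i - y ord0 i) ^+ 2)).
  by rewrite mulr_ge0 ?sqr_ge0// mulr_ge0 ?subr_ge0// ltW.
by rewrite le_eqVlt; apply/orP; left; apply/eqP; ring.
Qed.

Lemma euclidean_unit_ball_in_cube : in_cube 1 (@euclidean_unit_ball R n).
Proof.
move=> x /euclidean_unit_ballP x1 i.
rewrite -(@ler_pXn2r _ 2) ?nnegrE// expr1n real_normK ?num_real//.
apply: le_trans x1; rewrite (bigD1 i)//= lerDl.
by apply: sumr_ge0 => j _; exact: sqr_ge0.
Qed.

Lemma compact_in_cube K : compact K -> exists2 M, 0 <= M & in_cube M K.
Proof.
move=> /compact_bounded[M [_ MK]].
exists (`|M| + 1); first by rewrite addr_ge0.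
move=> x Kx i; apply: le_trans (MK (`|M| + 1) _ x Kx).
  by rewrite [leRHS]/Num.norm/= mx_normrE; apply/bigmax_geP; right => /=; exists (ord0, i).
by rewrite (le_lt_trans (ler_norm M))// ltrDl.
Qed.

(** Scaling [K] as well as the ball makes Steiner's polynomial homogeneous, and [s] becomes the
    variable of the generating function. *)
Definition parallel_body K (s l : R) : set 'rV[R]_n :=
  [set z | exists x y, [/\ K x, euclidean_unit_ball y & z = s *: x + l *: y]].

(** [is_convex_cone] merges the two points of [K] and the two points of the ball separately. The
    mixing is joint in [s] and [l]. *)
Lemma parallel_body_mixes K a s0 s1 l0 l1 : is_convex K -> 0 < a < 1 ->
  0 <= s0 -> 0 <= s1 -> 0 <= l0 -> 0 <= l1 ->
  mixes_into a (parallel_body K s0 l0) (parallel_body K s1 l1)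
    (parallel_body K ((1 - a) * s0 + a * s1) ((1 - a) * l0 + a * l1)).
Proof.
move=> cK /andP[a0 a1] s00 s10 l00 l10 _ _ [x [y [Kx By ->]]] [x' [y' [Kx' By' ->]]].
have b0 : 0 <= 1 - a by rewrite subr_ge0 ltW.
have {}a0 := ltW a0.
have [k Kk kE] := is_convex_cone cK (mulr_ge0 b0 s00) (mulr_ge0 a0 s10) Kx Kx'.
have [b Bb bE] := is_convex_cone euclidean_unit_ball_convex
  (mulr_ge0 b0 l00) (mulr_ge0 a0 l10) By By'.
by exists k, b; split => //; rewrite -kE -bE !scalerDr !scalerA addrACA.
Qed.

Lemma parallel_body_convex K s l : is_convex K -> 0 <= s -> 0 <= l ->
  is_convex (parallel_body K s l).
Proof.
move=> cK s0 l0 a a01; have := parallel_body_mixes cK a01 s0 s0 l0 l0.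
by rewrite -!mulrDl subrK !mul1r.
Qed.

Lemma parallel_body_in_cube K M s l : 0 <= s -> 0 <= l -> in_cube M K ->
  in_cube (s * M + l) (parallel_body K s l).
Proof.
move=> s0 l0 KM _ [x [y [Kx By ->]]] i; rewrite !mxE.
apply: le_trans (ler_normD _ _) _; rewrite !normrM (ger0_norm s0) (ger0_norm l0) lerD//.
  by rewrite ler_wpM2l// KM.
by rewrite ler_piMr// euclidean_unit_ball_in_cube.
Qed.

Lemma parallel_body1 K l :
  minkowski_sum K (dilation l (@euclidean_unit_ball R n)) = parallel_body K 1 l.
Proof.
apply/seteqP; split=> [z [x Kx [_ [y By <-] <-]]|z [x [y [Kx By ->]]]].
  by exists x, y; rewrite scale1r.
by exists x => //; exists (l *: y); [exists y|rewrite scale1r].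
Qed.

Lemma parallel_body_dilation K s l : s != 0 ->
  parallel_body K s l = dilation s (parallel_body K 1 (l / s)).
Proof.
move=> s0; apply/seteqP; split=> [z [x [y [Kx By ->]]]|_ [_ [x [y [Kx By ->]]] <-]].
  exists (1 *: x + (l / s) *: y); first by exists x, y.
  by rewrite scalerDr !scalerA mulr1 mulrC divfK.
by exists x, y; split=> //; rewrite scalerDr !scalerA mulr1 [s * _]mulrC divfK.
Qed.

End parallel_bodies.

(** * Exponentially weighted volumes of parallel bodies *)

Section steiner_generating_function.
Context {R : realType} (n : nat) (K : set 'rV[R]_n) (V : 'I_n.+1 -> R) (M : R).
Hypotheses (cK : is_convex K) (M0 : 0 <= M) (KM : in_cube M K).
Hypothesis steiner : steiner_formula K V.
Let mu := @lebesgue_measure R.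
Local Notation D := (`[0%R, +oo[%classic : set R).

Let c (i : 'I_n.+1) : R := kappa R (n - i) * V i.

(** Pulling [s] out of the body leaves Steiner's formula at [l / s], and
    [s^n (l / s)^(n-i) = s^i l^(n-i)]. *)
Lemma volume_parallel_body s l : 0 < s -> 0 <= l ->
  volume (parallel_body K s l) = (\sum_(i < n.+1) s ^+ i * c i * l ^+ (n - i))%:E.
Proof.
move=> s0 l0; have ls0 : 0 <= l / s by rewrite divr_ge0// ltW.
have sN0 : s != 0 by rewrite gt_eqF.
rewrite parallel_body_dilation//.
rewrite (@volume_dilation _ _ _ _ (1 * M + l / s))//; last 3 first.
- by rewrite mul1r addr_ge0.
- exact: parallel_body_convex.
- exact: parallel_body_in_cube.
rewrite -parallel_body1 steiner// -EFinM mulr_sumr; congr EFin.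
apply: eq_bigr => i _; have ni : (i <= n)%N by rewrite -ltnS.
rewrite -{1}(subnKC ni) exprD exprMn exprVn /c; field.
by rewrite expf_neq0.
Qed.

(** Extension by [0] to negative [l] keeps the function log-concave on the whole line, where
    Prekopa-Leindler is stated. *)
Definition damped_volume s : R -> R :=
  (fun l => expR (- l) * fine (volume (parallel_body K s l))) \_ D.

(** The function [Q] of the overview: each [l^(n-i)] has been integrated against [e^(-l)]. *)
Definition factorial_steiner_sum s : R :=
  \sum_(i < n.+1) s ^+ i * c i * (n - i)`!%:R.

Lemma damped_volume_ge0 s l : 0 <= damped_volume s l.
Proof.
rewrite /damped_volume patchE; case: ifP => // _.
by rewrite mulr_ge0 ?expR_ge0// fine_ge0// volume_ge0.
Qed.

Lemma damped_volumeE s : 0 < s -> damped_volume s =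
  (fun l => \sum_(i < n.+1) s ^+ i * c i * (l ^+ (n - i) * expR (- l))) \_ D.
Proof.
move=> s0; apply/funext => l; rewrite /damped_volume !patchE.
case: ifPn => // /set_mem/=; rewrite in_itv/= andbT => l0.
rewrite volume_parallel_body//= mulr_sumr; apply: eq_bigr => i _; ring.
Qed.

Lemma Rintegral_damped_volume s : 0 < s ->
  \int[mu]_l damped_volume s l = factorial_steiner_sum s.
Proof.
move=> s0; rewrite damped_volumeE// -Rintegral_mkcond.
exact: (polynomial_expRN_Rintegral _ _ _).2.
Qed.

Lemma integral_damped_volume_lty s : 0 < s ->
  (\int[mu]_l (damped_volume s l)%:E < +oo)%E.
Proof.
move=> s0; have := (polynomial_expRN_Rintegral (index_enum 'I_n.+1)
  (fun i => s ^+ i * c i) (fun i : 'I_n.+1 => (n - i)%N)).1.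
move=> /integrable_fin_num -/(_ (measurable_itv _)); rewrite integral_mkcond.
rewrite restrict_EFin -damped_volumeE// ge0_fin_numE//.
by apply: integral_ge0 => l _; rewrite lee_fin damped_volume_ge0.
Qed.

Lemma expRN_monomial_le (k : nat) (l : R) : 0 <= l ->
  l ^+ k * expR (- l) <= k`!%:R.
Proof.
move=> l0; rewrite expRN ler_pdivrMr ?expR_gt0//.
case: k => [|k]; first by rewrite expr0 fact0 mul1r -expR0 ler_expR.
have k0 : 0 < k.+1`!%:R :> R by rewrite ltr0n fact_gt0.
rewrite -ler_pdivrMl// mulrC; apply: le_trans (expR_ge1Dxn k l0).
by rewrite lerDr.
Qed.

(** A bound uniform in [l], as Prekopa-Leindler requires, obtained from [l^k e^(-l) <= k!]. *)
Definition damped_volume_bound s : R :=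
  \sum_(i < n.+1) `|s ^+ i * c i| * (n - i)`!%:R.

Lemma damped_volume_bound_ge0 s : 0 <= damped_volume_bound s.
Proof. by apply: sumr_ge0 => i _; rewrite mulr_ge0. Qed.

Lemma damped_volume_le s l : 0 < s -> damped_volume s l <= damped_volume_bound s.
Proof.
move=> s0; rewrite damped_volumeE// patchE; case: ifPn => [|_]; last first.
  exact: damped_volume_bound_ge0.
move=> /set_mem/=; rewrite in_itv/= andbT => l0; apply: ler_sum => i _.
apply: le_trans (ler_norm _) _; rewrite normrM ler_wpM2l//.
by rewrite ger0_norm ?expRN_monomial_le// mulr_ge0 ?exprn_ge0 ?expR_ge0.
Qed.

(** The exponential factor gives equality and the volume factor obeys Brunn-Minkowski, since
    parallel bodies mix. For negative [l0] or [l1] the left side is [0]. *)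
Lemma damped_volume_logconcave a s0 s1 : 0 < a < 1 -> 0 < s0 -> 0 < s1 ->
  logconcave_triple a (damped_volume s0) (damped_volume s1)
    (damped_volume ((1 - a) * s0 + a * s1)).
Proof.
move=> a01 s00 s10 l0 l1; have /andP[a0 a1] := a01.
have b0 : 0 < 1 - a by rewrite subr_gt0.
rewrite {1}/damped_volume patchE; case: ifPn => [|_]; last first.
  by rewrite powR0 ?gt_eqF// mul0r damped_volume_ge0.
move=> /set_mem/=; rewrite in_itv/= andbT => l00.
rewrite {1}/damped_volume patchE; case: ifPn => [|_]; last first.
  by rewrite powR0 ?(gt_eqF a0)// mulr0 damped_volume_ge0.
move=> /set_mem/=; rewrite in_itv/= andbT => l10.
have l20 : 0 <= (1 - a) * l0 + a * l1.
  by rewrite addr_ge0 ?mulr_ge0 ?(ltW a0) ?(ltW b0).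
rewrite /damped_volume patchE mem_set/=; last by rewrite in_itv/= andbT.
rewrite !powRM ?expR_ge0 ?fine_ge0 ?volume_ge0// mulrACA.
rewrite -!expRM -expRD.
have -> : - l0 * (1 - a) + - l1 * a = - ((1 - a) * l0 + a * l1) by ring.
rewrite ler_wpM2l ?expR_ge0//.
(* Half the side of a cube containing all three bodies. *)
pose C := s0 * M + l0 + (s1 * M + l1).
have C0 : 0 <= s0 * M + l0 by rewrite addr_ge0 ?mulr_ge0 ?(ltW s00).
have C1 : 0 <= s1 * M + l1 by rewrite addr_ge0 ?mulr_ge0 ?(ltW s10).
have cube_le (A : set 'rV[R]_n) (x y : R) : x <= y -> in_cube x A -> in_cube y A.
  by move=> xy Ax z Az i; rewrite (le_trans (Ax z Az i)).
have s20 : 0 <= (1 - a) * s0 + a * s1 by rewrite addr_ge0 ?mulr_ge0 ?ltW.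
apply: ((volume_finite_brunn_minkowski n).2 _ _ _ _ C a01).
- by rewrite addr_ge0.
- by apply: parallel_body_convex => //; exact: ltW.
- by apply: parallel_body_convex => //; exact: ltW.
- exact: parallel_body_convex.
- apply: (@cube_le _ (s0 * M + l0)); first by rewrite lerDl.
  by apply: parallel_body_in_cube => //; exact: ltW.
- apply: (@cube_le _ (s1 * M + l1)); first by rewrite lerDr.
  by apply: parallel_body_in_cube => //; exact: ltW.
- apply: (@cube_le _ (((1 - a) * s0 + a * s1) * M + ((1 - a) * l0 + a * l1))).
    have := mulr_ge0 (ltW a0) C0; have := mulr_ge0 (ltW b0) C1; rewrite /C; lra.
  exact: parallel_body_in_cube.
- by apply: parallel_body_mixes => //; exact: ltW.
Qed.

Lemma damped_volume_superlevel s t : 0 < s ->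
  is_interval (superlevel (damped_volume s) t).
Proof.
move=> s0; apply: logconcave_superlevel; first exact: damped_volume_ge0.
move=> a a01; have := @damped_volume_logconcave a s s a01 s0 s0.
by rewrite -mulrDl subrK mul1r.
Qed.

Lemma factorial_steiner_sum_ge0 s : 0 < s -> 0 <= factorial_steiner_sum s.
Proof.
move=> s0; rewrite -Rintegral_damped_volume//; apply: Rintegral_ge0 => l _.
exact: damped_volume_ge0.
Qed.

(** Prekopa-Leindler in [l]: a marginal of a jointly log-concave function is log-concave. *)
Lemma factorial_steiner_sum_logconcave a s0 s1 : 0 < a < 1 -> 0 < s0 -> 0 < s1 ->
  factorial_steiner_sum s0 `^ (1 - a) * factorial_steiner_sum s1 `^ a <=
  factorial_steiner_sum ((1 - a) * s0 + a * s1).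
Proof.
move=> a01 s00 s10; have /andP[a0 a1] := a01.
have s20 : 0 < (1 - a) * s0 + a * s1 by rewrite addr_gt0 ?mulr_gt0 ?subr_gt0.
rewrite -!Rintegral_damped_volume//.
apply: (@prekopa_leindler _ a (damped_volume_bound s0 + damped_volume_bound s1)) => //;
  do ?[exact: damped_volume_ge0|by move=> t; exact: damped_volume_superlevel].
- by move=> l; rewrite ler_wpDr ?damped_volume_bound_ge0// damped_volume_le.
- by move=> l; rewrite ler_wpDl ?damped_volume_bound_ge0// damped_volume_le.
- exact: integral_damped_volume_lty.
- exact: damped_volume_logconcave.
Qed.

End steiner_generating_function.

(** * Rotation volumes *)

Section finite_random_variable.
Context {R : realType} (n : nat) (d : measure_display) (T : measurableType d).
Context (P : probability T R) (I : {RV P >-> R}).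
Hypothesis I_range : forall w, exists k : 'I_n.+1, I w = k%:R.

Lemma finite_rv_integral (F : R -> R) : (forall k : 'I_n.+1, 0 <= F k%:R) ->
  (\int[P]_w (F (I w))%:E =
   \sum_(k < n.+1) (F k%:R)%:E * P [set w | I w = k%:R])%E.
Proof.
move=> F0.
have mI (k : 'I_n.+1) : measurable [set w | I w = k%:R].
  rewrite (_ : [set w | _] = I @^-1` [set k%:R])//; exact: measurable_funPTI.
transitivity (\int[P]_w (\sum_(k < n.+1)
    (F k%:R)%:E * (\1_[set w | I w = k%:R] w)%:E))%E.
  apply: eq_integral => w _; have [k Iw] := I_range w.
  rewrite (bigD1 k)//= [X in (_ + X)%E]big1 ?adde0; last first.
    move=> j jk; rewrite indicE memNset ?mule0//= Iw => /eqP.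
    by rewrite eqr_nat => /eqP/val_inj kj; move: jk; rewrite kj eqxx.
  by rewrite indicE mem_set//= mule1 Iw.
rewrite ge0_integral_sum//; last 2 first.
- move=> k; apply: measurable_funeM; apply/measurable_EFinP.
  exact: measurable_indic.
- by move=> k w _; rewrite mule_ge0 ?lee_fin.
apply: eq_bigr => k _; rewrite ge0_integralZl_EFin//; last first.
  by apply/measurable_EFinP; exact: measurable_indic.
by rewrite integral_indic// setIT.
Qed.

Variable p : 'I_n.+1 -> R.
Hypothesis pE : forall k : 'I_n.+1, P [set w | I w = k%:R] = (p k)%:E.

Lemma finite_rv_integral_fin (F : R -> R) : (forall k : 'I_n.+1, 0 <= F k%:R) ->
  (\int[P]_w (F (I w))%:E = (\sum_(k < n.+1) F k%:R * p k)%:E)%E.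
Proof.
move=> F0; rewrite finite_rv_integral// -sumEFin.
by apply: eq_bigr => k _; rewrite pE EFinM.
Qed.

Lemma finite_rv_ge0 k : 0 <= p k.
Proof. by rewrite -lee_fin -pE. Qed.

Lemma finite_rv_sum1 : \sum_k p k = 1.
Proof.
have := @finite_rv_integral_fin (fun=> 1) (fun=> ler01).
rewrite integral_cst// [X in (_ * X)%E](probability_setT P) mule1 => -[->].
by apply: eq_bigr => k _; rewrite mul1r.
Qed.

Lemma finite_rv_expectation : fine 'E_P[I] = pgf_mean p.
Proof.
by rewrite unlock (@finite_rv_integral_fin id)// => k; rewrite ler0n.
Qed.

Lemma finite_rv_deviation (m t : R) :
  P [set w | t <= `|I w - m|] = (\sum_(k < n.+1 | t <= `|k%:R - m|) p k)%:E.
Proof.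
pose F (r : R) : R := (t <= `|r - m|)%R%:R.
have mA : measurable [set w | t <= `|I w - m|].
  have : measurable_fun setT (fun w => (t <= `|I w - m|)%R).
    apply: measurable_fun_ler => //; apply: measurableT_comp => //.
    exact: measurable_funB.
  by move=> /(_ measurableT [set true]); rewrite setTI; exact.
transitivity (\int[P]_w (F (I w))%:E)%E.
  rewrite -[X in P X]setIT -integral_indic//; apply: eq_integral => w _.
  rewrite indicE /F; congr (nat_of_bool _)%:R%:E.
  by apply/idP/idP; rewrite inE.
rewrite finite_rv_integral_fin; last by move=> k; rewrite ler0n.
congr EFin; rewrite [RHS]big_mkcond/=; apply: eq_bigr => k _.
by rewrite /F; case: ifP => _; rewrite ?mul1r ?mul0r.
Qed.

End finite_random_variable.

(** * The generating function of the rotation volume variable *)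

Section rotation_volumes.
Context {R : realType} (n : nat) (K : set 'rV[R]_n).
Hypothesis K_body : convex_body K.
Hypothesis steiner : steiner_formula K (intrinsic_volume K).
Let W := total_rotation_volume K.
(** The value [n - i] carries the rotation volume of index [i], so the reversal makes [p k] the
    probability of the value [k]. *)
Let p (k : 'I_n.+1) := rotation_volume K (rev_ord k) / W.

(** By [kappa_factorial] the coefficient of [s^i] carries [(2 pi)^(n-i)]; its part [(2 pi)^n] joins
    the constant and [(2 pi)^(-i)] rescales the argument. *)
Lemma factorial_steiner_sum_pgf s : W != 0 ->
  factorial_steiner_sum (intrinsic_volume K) s =
  2 * (2 * pi) ^+ n / omega R n.+1 * W * pgf p (s / (2 * pi)).
Proof.
move=> W0; have pi0 : pi != 0 :> R by rewrite gt_eqF ?pi_gt0.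
rewrite /factorial_steiner_sum /pgf mulr_sumr; apply: eq_bigr => i _.
have ni : (i <= n)%N by rewrite -ltnS.
rewrite -mulrA [kappa _ _ * _ * _]mulrAC kappa_factorial /p /rotation_volume.
rewrite rev_ordK /= subSS.
have -> : (2 * pi) ^+ n = (2 * pi) ^+ i * (2 * pi) ^+ (n - i) :> R.
  by rewrite -exprD subnKC.
rewrite [(s / _) ^+ i]exprMn exprVn.
have := omega_gt0 (R := R) n; have := omega_gt0 (R := R) (n - i).
set o := omega R _; set o' := omega R _ => o0 o'0; field.
by rewrite (gt_eqF o0) (gt_eqF o'0) W0 expf_neq0// mulf_neq0.
Qed.

(** Log-concavity of [factorial_steiner_sum] between [2 pi] and [2 pi s] becomes that of [pgf p]
    between [1], where it equals [1], and [s]; the positive constant [C] cancels. *)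
Lemma pgf_rotation_le :  W != 0 -> (forall k, 0 <= p k) -> \sum_k p k = 1 ->
  forall s, 0 < s -> pgf p s <= expR (pgf_mean p * (s - 1)).
Proof.
move=> W0 p0 p1 s s0; apply: pgf_le_poisson => // a a01.
have pi0 : 0 < 2 * pi :> R by rewrite mulr_gt0 ?pi_gt0.
have [M M0 KM] := compact_in_cube K_body.1.
have cK := convex_set_is_convex K_body.2.
pose C : R := 2 * (2 * pi) ^+ n / omega R n.+1 * W.
have QE r : factorial_steiner_sum (intrinsic_volume K) (r * (2 * pi)) = C * pgf p r.
  by rewrite factorial_steiner_sum_pgf// mulfK ?gt_eqF.
have pgf1 : pgf p 1 = 1.
  by rewrite /pgf -[RHS]p1; apply: eq_bigr => i _; rewrite expr1n mulr1.
(* The sign of [W] is not known beforehand; but [C] is nonzero and is the value at [2 pi] of an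
   integral of volumes. *)
have C0 : 0 < C.
  rewrite lt_neqAle eq_sym; apply/andP; split.
    rewrite /C !mulf_neq0// ?invr_neq0 ?expf_neq0 ?gt_eqF ?omega_gt0//.
  have := factorial_steiner_sum_ge0 cK M0 KM steiner (mulr_gt0 ltr01 pi0).
  by rewrite QE pgf1 mulr1.
have := factorial_steiner_sum_logconcave cK M0 KM steiner a01
  (mulr_gt0 ltr01 pi0) (mulr_gt0 s0 pi0).
have -> : (1 - a) * (1 * (2 * pi)) + a * (s * (2 * pi)) =
    (1 + a * (s - 1)) * (2 * pi) by ring.
rewrite !QE pgf1 mulr1 powRM ?(ltW C0) ?(ltW (pgf_gt0 _ _ _))//.
rewrite mulrA -powRD ?subrK ?(gt_eqF C0) ?implybT// powRr1 ?(ltW C0)//.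
by rewrite ler_pM2l.
Qed.

End rotation_volumes.

Theorem theorem1 (R : realType) (n : nat) (n_gt0 : (0 < n)%N)
    (K : set 'rV[R]_n) (K_body : convex_body K) (K_neq0 : K !=set0)
    (d : measure_display) (T : measurableType d) (P : probability T R)
    (I : {RV P >-> R}) (I_rv : rotation_volume_rv K I) :
  let delta := central_rotation_volume I in
  let sigma2 := delta in
  forall t : R, 0 <= t ->
    (P [set w | (t <= `| I w - delta |)%R] <=
      (2 * expR ((- t ^+ 2 / 2) / (sigma2 + t / 3)))%:E)%E.
Proof.
move=> delta sigma2 t t0.
have [I_range I_prob] := I_rv.
pose p (k : 'I_n.+1) := rotation_volume K (rev_ord k) / total_rotation_volume K.
have pE (k : 'I_n.+1) : P [set w | I w = k%:R] = (p k)%:E.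
  by rewrite -I_prob /= subSS subKn// -ltnS.
have p0 := finite_rv_ge0 pE.
have p1 := finite_rv_sum1 I_range pE.
(* Division by [0] gives [0], so every [p k] would vanish, against total mass [1]. *)
have W0 : total_rotation_volume K != 0.
  apply/eqP => W0; have := oner_neq0 R; rewrite -p1 big1 ?eqxx// => k _.
  by rewrite /p W0 invr0 mulr0.
have steiner : steiner_formula K (intrinsic_volume K).
  apply: xgetPex; apply: contrapT => noV; move: W0; apply/negP; rewrite negbK.
  rewrite /total_rotation_volume big1// => k _.
  rewrite /rotation_volume /intrinsic_volume xgetPN ?mulr0// => V VS.
  by apply: noV; exists V.
have deltaE : delta = pgf_mean p by exact: finite_rv_expectation.
rewrite /sigma2 deltaE (finite_rv_deviation I_range pE) lee_fin.
apply: bernstein_concentration => //.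
exact: pgf_rotation_le.
Qed.
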